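(* In the setting below, there exist nonnegative weights $\xi_0$, $\{\xi^x_i\}_{i=1}^k$, $\{\xi^y_j\}_{j=1}^c$ summing to one (functions of the data) such that for every measurable $C\subseteq\mathbb{X}$ $$\mathbb{P}\big(X_{n+1}\in C\mid (X_i)_{i=1}^n,(Y_j)_{j=1}^m\big)=\xi_0P_0(C)+\sum_{i=1}^k\xi^x_i\delta_{X_i^*}(C)+\sum_{j=1}^c\xi^y_jR_{Y_j^*}(C).$$ Analogously there exist nonnegative weights $\eta_0$, $\{\eta^y_j\}_{j=1}^c$, $\{\eta^x_i\}_{i=1}^k$ summing to one such that $$\mathbb{P}\big(Y_{m+1}\in C\mid (X_i)_{i=1}^n,(Y_j)_{j=1}^m\big)=\eta_0P_0(C)+\sum_{j=1}^c\eta^y_j\delta_{Y_j^*}(C)+\sum_{i=1}^k\eta^x_iQ_{X_i^*}(C).$$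
   Context: FuRBI setup. $\mathbb{X}$ is a Polish space, $\theta>0$, $G_0$ a non-atomic probability measure on $\mathbb{X}^2$ with both marginals equal to $P_0$; $\rho$ a measure on $[0,\infty)^2\setminus\{(0,0)\}$ with $\int\min\{1,s_1+s_2\}\rho(\mathrm{d}s)<\infty$ whose two marginal jump measures on $(0,\infty)$ coincide and have infinite mass. $(\mu_1,\mu_2)$ is a completely random vector on $\mathbb{X}^2$ (independent evaluations on pairwise disjoint sets), with no fixed atoms or deterministic part and Lévy intensity $\theta\rho(\mathrm{d}s_1,\mathrm{d}s_2)G_0(\mathrm{d}x)$. The n-FuRBI are $\tilde p_1(A)=\mu_1(A\times\mathbb{X})/\mu_1(\mathbb{X}^2)$ and $\tilde p_2(B)=\mu_2(\mathbb{X}\times B)/\mu_2(\mathbb{X}^2)$. $G_0$ has density $g_0$ w.r.t. $\lambda\otimes\lambda$ for a σ-finite $\lambda$, $P_0$ has density $p_0$ w.r.t. $\lambda$; $Q_x(\mathrm{d}y)=g_0(x,y)\lambda(\mathrm{d}y)/p_0(x)$ (law of second coordinate given first $=x$ under $G_0$) and $R_y(\mathrm{d}x)=g_0(x,y)\lambda(\mathrm{d}x)/p_0(y)$ (law of first coordinate given second $=y$). Conditionally on $(\tilde p_1,\tilde p_2)$, $X_1,X_2,\dots$ are i.i.d. $\tilde p_1$ and $Y_1,Y_2,\dots$ i.i.d. $\tilde p_2$, independent. Given $n,m\ge1$, $X^*_1,\dots,X^*_k$ are the distinct values among $X_1,\dots,X_n$ and $Y^*_1,\dots,Y^*_c$ the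 distinct values among $Y_1,\dots,Y_m$. *)

(* Defs.v *)
From mathcomp Require Import all_boot all_algebra.
From mathcomp Require Import all_classical all_reals all_analysis measurable_realfun.
Import GRing.Theory Num.Theory.

Set Implicit Arguments.
Unset Strict Implicit.
Unset Printing Implicit Defensive.

Local Open Scope classical_set_scope.
Local Open Scope ring_scope.

Section FuRBI_defs.
Variable R : realType.

Definition dist_ball {T : Type} (dist : T -> T -> R) (x : T) (e : R) : set T :=
  [set y | dist x y < e].

Definition dist_open {T : Type} (dist : T -> T -> R) (A : set T) : Prop :=
  forall x, A x -> exists2 e : R, 0 < e & dist_ball dist x e `<=` A.

Definition polish_space (d : measure_display) (X : measurableType d) : Prop :=
  exists dist : X -> X -> R,
  [/\ (forall x y, dist x y = 0 <-> x = y) /\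
      (forall x y, dist x y = dist y x),
      (forall x y z, dist x z <= dist x y + dist y z),
      (forall u : nat -> X,
         (forall e : R, 0 < e -> exists N, forall p q, (N <= p)%N -> (N <= q)%N ->
            dist (u p) (u q) < e) ->
         exists l : X, forall e : R, 0 < e -> exists N, forall p, (N <= p)%N ->
            dist (u p) l < e),
      (exists D : nat -> X, forall x (e : R), 0 < e -> exists k, dist x (D k) < e) &
      (@measurable _ X = <<s dist_open dist >>)].

Definition sigma_gen_seq (dO : measure_display) (Omega : measurableType dO)
  (d : measure_display) (X : measurableType d) (Z : nat -> Omega -> X) (n : nat)
  : set (set Omega) :=
  \bigcup_(i in `I_n) preimage_set_system setT (Z i) measurable.

(* sigma-algebra generated by X_1..X_n and Y_1..Y_m (0-based: X 0 .. X (n-1)) *)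
Definition sigma_data (dO : measure_display) (Omega : measurableType dO)
  (d : measure_display) (X : measurableType d) (Xs Ys : nat -> Omega -> X) (n m : nat)
  : set (set Omega) :=
  <<s sigma_gen_seq Xs n `|` sigma_gen_seq Ys m >>.

Definition measurable_wrt (dO : measure_display) (Omega : measurableType dO)
  (F : set (set Omega)) (f : Omega -> R) : Prop :=
  forall B : set R, measurable B -> F (f @^-1` B).

Definition ptilde1 (dO : measure_display) (Omega : measurableType dO)
  (d : measure_display) (X : measurableType d)
  (mu1 : Omega -> {measure set (X * X)%type -> \bar R}) (w : Omega) (A : set X) : R :=
  fine (mu1 w (A `*` setT)) / fine (mu1 w setT).

Definition ptilde2 (dO : measure_display) (Omega : measurableType dO)
  (d : measure_display) (X : measurableType d)
  (mu2 : Omega -> {measure set (X * X)%type -> \bar R}) (w : Omega) (B : set X) : R :=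
  fine (mu2 w (setT `*` B)) / fine (mu2 w setT).

Definition sigma_ptilde (dO : measure_display) (Omega : measurableType dO)
  (d : measure_display) (X : measurableType d)
  (mu1 mu2 : Omega -> {measure set (X * X)%type -> \bar R}) : set (set Omega) :=
  <<s [set E | exists A (B : set R), [/\ measurable A, measurable B &
          (E = [set w | B (ptilde1 mu1 w A)] \/ E = [set w | B (ptilde2 mu2 w A)])]] >>.

Definition expmE (x : \bar R) : R :=
  match x with
  | EFin r => expR (- r)
  | _ => 0
  end.

(* (i) random measures: each evaluation mu_i(A) is a random variable;
   (ii) independence of (mu1(A_i), mu2(A_i)) over pairwise disjoint A_1..A_N;
   (iii) the law of (mu1(A), mu2(A)) is given by the Levy intensity
         theta rho(ds1,ds2) G0(dx) (no fixed atoms, no deterministic part):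
         E[e^{-l1 mu1(A) - l2 mu2(A)}]
           = exp(- theta G0(A) \int (1 - e^{-l1 s1 - l2 s2}) rho(ds)). *)
Definition completely_random_vector (dO : measure_display) (Omega : measurableType dO)
  (P : probability Omega R) (d : measure_display) (X : measurableType d)
  (theta : R) (rho : {measure set (measurableTypeR R * measurableTypeR R)%type -> \bar R})
  (G0 : probability (X * X)%type R)
  (mu1 mu2 : Omega -> {measure set (X * X)%type -> \bar R}) : Prop :=
  [/\ (forall A, measurable A ->
         measurable_fun setT (fun w => mu1 w A) /\ measurable_fun setT (fun w => mu2 w A)),
      (forall (N : nat) (A : nat -> set (X * X)%type) (B : nat -> set (\bar R * \bar R)%type),
         (forall i, (i < N)%N -> measurable (A i) /\ measurable (B i)) ->
         (forall i j, (i < N)%N -> (j < N)%N -> i <> j -> A i `&` A j = set0) ->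
         P (\bigcap_(i in `I_N) [set w | B i (mu1 w (A i), mu2 w (A i))]) =
         (\prod_(i < N) P [set w | B i (mu1 w (A i), mu2 w (A i))])%E) &
      (forall (A : set (X * X)%type) (l1 l2 : R), measurable A -> 0 <= l1 -> 0 <= l2 ->
         (\int[P]_w (expmE (l1%:E * mu1 w A + l2%:E * mu2 w A)%E)%:E)%E =
         (expR (- (theta * fine (G0 A) *
            fine (\int[rho]_s (1 - expR (- (l1 * s.1 + l2 * s.2)))%:E)%E)))%:E)].

(* Given (ptilde1, ptilde2), the X_i are i.i.d. ptilde1, the Y_j i.i.d. ptilde2,
   and the two sequences are independent: for every event E in sigma(ptilde1, ptilde2),
   P(E, X_0 in A_0, ..., X_{n-1} in A_{n-1}, Y_0 in B_0, ..., Y_{m-1} in B_{m-1})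
     = E[ 1_E prod_i ptilde1(A_i) prod_j ptilde2(B_j) ]. *)
Definition cond_iid (dO : measure_display) (Omega : measurableType dO)
  (P : probability Omega R) (d : measure_display) (X : measurableType d)
  (mu1 mu2 : Omega -> {measure set (X * X)%type -> \bar R})
  (Xs Ys : nat -> Omega -> X) : Prop :=
  (forall i, measurable_fun setT (Xs i)) /\ (forall j, measurable_fun setT (Ys j)) /\
  forall (n m : nat) (A B : nat -> set X) (E : set Omega),
    (forall i, measurable (A i)) -> (forall j, measurable (B j)) ->
    sigma_ptilde mu1 mu2 E ->
    P (E `&` (\bigcap_(i in `I_n) (Xs i @^-1` A i))
         `&` (\bigcap_(j in `I_m) (Ys j @^-1` B j))) =
    (\int[P]_(w in E)
       ((\prod_(i < n) ptilde1 mu1 w (A i)) * (\prod_(j < m) ptilde2 mu2 w (B j)))%:E)%E.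

Definition Qker (d : measure_display) (X : measurableType d)
  (lam : {measure set X -> \bar R}) (g0 : X * X -> R) (p0 : X -> R) (x : X) (C : set X)
  : \bar R :=
  ((\int[lam]_(y in C) (g0 (x, y))%:E) * ((p0 x)^-1)%:E)%E.

Definition Rker (d : measure_display) (X : measurableType d)
  (lam : {measure set X -> \bar R}) (g0 : X * X -> R) (p0 : X -> R) (y : X) (C : set X)
  : \bar R :=
  ((\int[lam]_(x in C) (g0 (x, y))%:E) * ((p0 y)^-1)%:E)%E.

Definition distinct_vals (dO : measure_display) (Omega : measurableType dO)
  (d : measure_display) (X : measurableType d) (Z : nat -> Omega -> X) (n : nat)
  (w : Omega) : seq X :=
  undup [seq Z i w | i <- iota 0 n].

End FuRBI_defs.

(* Main.v *)
(* The predictive law is a mixture over the set partitions of the n + m + 1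
   items, namely the observations and the next one, into blocks sharing an atom
   of (mu1, mu2).  Differentiating the Laplace functional of a completely random
   vector expresses the joint moments of its unnormalised evaluations as a sum
   over set partitions of products of block terms, each the product of a jump
   integral and of the G0-probability that one location meets the requirements
   of all the items of the block.  As 1 / T is the integral of exp(- s T) over
   s > 0, dividing by the total masses only changes the nonnegative
   coefficients.  Hence the items follow a mixture of laws under which distinct
   blocks have independent locations of law G0.  In each component the next item
   is either alone in its block, and has law P0, or shares the location of an
   observation, and given the data is then distributed as a point mass or as the
   conditional law Q or R of the other coordinate.  Radon-Nikodym densities turn
   the mixture weights into posterior ones, which are finally pooled over the
   observations with the same value. *)
From HB Require Import structures.
Require Import Defs.
From mathcomp Require Import all_boot all_order all_algebra.
From mathcomp Require Import all_classical all_reals all_analysis measurable_realfun.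
From mathcomp Require Import ring lra.
Import Order.TTheory GRing.Theory Num.Theory.
Import numFieldNormedType.Exports.
Set Implicit Arguments.
Unset Strict Implicit.
Unset Printing Implicit Defensive.
Local Open Scope classical_set_scope.
Local Open Scope ring_scope.

Lemma measurable_preimageT d1 d2 (T1 : measurableType d1) (T2 : measurableType d2)
    (f : T1 -> T2) (B : set T2) :
  measurable_fun setT f -> measurable B -> measurable (f @^-1` B).
Proof. by move=> mf mB; rewrite -[X in measurable X]setTI; exact: mf. Qed.

(** * Decay rates *)

Section decay_rate.
Context {R : realType}.
Implicit Types (f g : R -> R) (l : R).

Definition decrement_quotient f (p : nat) : R :=
  p.+1%:R * (f 0 - f p.+1%:R^-1).

(* The opposite of the right derivative at 0, so that Laplace transforms have
   nonnegative rates; a sequence of increments suffices for dominated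
   convergence. *)
Definition decay_rate f l := decrement_quotient f @ \oo --> l.

Lemma decay_rate_cvg f l : decay_rate f l -> f p.+1%:R^-1 @[p --> \oo] --> f 0.
Proof.
move=> fl.
have -> : (fun p : nat => f p.+1%:R^-1) =
    (fun p => f 0 - p.+1%:R^-1 * decrement_quotient f p).
  by apply/funext => p; rewrite /decrement_quotient mulKf ?pnatr_eq0//; ring.
rewrite -[X in _ --> X]subr0; apply: cvgB; first exact: cvg_cst.
by rewrite -[X in _ --> X](mul0r l); apply: cvgM => //; exact: cvg_harmonic.
Qed.

Lemma eq_decay_rate f g l : (forall s, 0 <= s -> f s = g s) ->
  decay_rate f l -> decay_rate g l.
Proof.
move=> fg; rewrite /decay_rate (_ : decrement_quotient g = decrement_quotient f)//.
by apply/funext => p; rewrite /decrement_quotient !fg// invr_ge0.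
Qed.

Lemma decay_rate_unique f l l' : decay_rate f l -> decay_rate f l' -> l = l'.
Proof. by move=> fl fl'; exact: (cvg_unique (@Rhausdorff R) fl fl'). Qed.

Lemma decay_rate_cst (a : R) : decay_rate (fun=> a) 0.
Proof.
rewrite /decay_rate (_ : decrement_quotient _ = fun=> 0); first exact: cvg_cst.
by apply/funext => p; rewrite /decrement_quotient subrr mulr0.
Qed.

Lemma decay_rateD f g l l' : decay_rate f l -> decay_rate g l' ->
  decay_rate (fun s => f s + g s) (l + l').
Proof.
move=> fl gl'; rewrite /decay_rate (_ : decrement_quotient _ =
    (fun p => decrement_quotient f p + decrement_quotient g p)); first exact: cvgD.
by apply/funext => p; rewrite /decrement_quotient; ring.
Qed.

Lemma decay_rateM f g l l' : decay_rate f l -> decay_rate g l' ->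
  decay_rate (fun s => f s * g s) (l * g 0 + f 0 * l').
Proof.
move=> fl gl'; rewrite /decay_rate (_ : decrement_quotient _ = (fun p =>
    decrement_quotient f p * g 0 + f p.+1%:R^-1 * decrement_quotient g p)).
  apply: cvgD; first by apply: cvgM => //; exact: cvg_cst.
  by apply: cvgM => //; exact: decay_rate_cvg fl.
by apply/funext => p; rewrite /decrement_quotient; ring.
Qed.

Lemma decay_rateZ (a : R) f l : decay_rate f l -> decay_rate (fun s => a * f s) (a * l).
Proof. by move=> /(decay_rateM (decay_rate_cst a)); rewrite mul0r add0r. Qed.

Lemma decay_rate_sum (I : eqType) (s : seq I) (f : I -> R -> R) (l : I -> R) :
  {in s, forall i, decay_rate (f i) (l i)} ->
  decay_rate (fun t => \sum_(i <- s) f i t) (\sum_(i <- s) l i).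
Proof.
elim: s => [|i s ih] fl.
  by under eq_fun do rewrite big_nil; rewrite big_nil; exact: decay_rate_cst.
under eq_fun do rewrite big_cons; rewrite big_cons.
apply: decay_rateD; first by apply: fl; rewrite mem_head.
by apply: ih => j js; apply: fl; rewrite inE js orbT.
Qed.

Lemma onem_expRN_bounds (x : R) : 0 <= x -> x / (1 + x) <= 1 - expR (- x) <= x.
Proof.
move=> x0; have x1 : 0 < 1 + x by lra.
have : expR (- x) <= (1 + x)^-1 by rewrite expRN lef_pV2 ?posrE ?expR_gt0// expR_ge1Dx.
have -> : x / (1 + x) = 1 - (1 + x)^-1 by field; rewrite lt0r_neq0.
by have := expR_ge1Dx (- x); lra.
Qed.

Lemma onem_expRN_ge0 (x : R) : 0 <= x -> 0 <= 1 - expR (- x).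
Proof. by move=> x0; rewrite subr_ge0 -expR0 ler_expR oppr_le0. Qed.

Lemma expRN_le1 (x : R) : 0 <= x -> expR (- x) <= 1.
Proof. by move=> /onem_expRN_ge0; rewrite subr_ge0. Qed.

Lemma cvg_onem_expRN (u : nat -> R) (l : R) : (forall p, 0 <= u p) ->
  p.+1%:R * u p @[p --> \oo] --> l ->
  p.+1%:R * (1 - expR (- u p)) @[p --> \oo] --> l.
Proof.
move=> u0 ul.
have u_cvg0 : u @ \oo --> 0.
  rewrite (_ : u = fun p => p.+1%:R^-1 * (p.+1%:R * u p)); last first.
    by apply/funext => p; rewrite mulKf ?pnatr_eq0.
  by rewrite -[X in _ --> X](mul0r l); apply: cvgM => //; exact: cvg_harmonic.
apply: (@squeeze_cvgr _ _ _ _ (fun p => (p.+1%:R * u p) / (1 + u p))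
          (fun p => p.+1%:R * u p)) => //.
  by apply: nearW => p; rewrite -mulrA !ler_pM2l ?ltr0n//; exact: onem_expRN_bounds.
have -> : l = l / (1 + 0) by rewrite addr0 divr1.
apply: cvgM => //; apply: cvgV; first by rewrite addr0 oner_eq0.
by apply: cvgD => //; exact: cvg_cst.
Qed.

Lemma decay_rate_expRN f l : (forall s, 0 <= s -> f 0 <= f s) -> decay_rate f (- l) ->
  decay_rate (fun s => expR (- f s)) (l * expR (- f 0)).
Proof.
move=> f_min fl; rewrite /decay_rate (_ : decrement_quotient _ =
    (fun p => p.+1%:R * (1 - expR (- (f p.+1%:R^-1 - f 0))) * expR (- f 0))); last first.
  apply/funext => p; rewrite /decrement_quotient -mulrA mulrBl mul1r -expRD.
  by congr (_ * (_ - expR _)); ring.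
apply: cvgM; last exact: cvg_cst.
apply: cvg_onem_expRN => [p|]; first by rewrite subr_ge0 f_min// invr_ge0.
rewrite -[X in _ --> X]opprK (_ : (fun _ => _) = - decrement_quotient f); first exact: cvgN.
by apply/funext => p; rewrite /decrement_quotient opprfctE; ring.
Qed.

End decay_rate.

Section integral_decay_rate.
Context {R : realType} d (T : measurableType d) (m : {measure set T -> \bar R}).
Implicit Types phi om : T -> R.

Lemma le_ge0_integrable (f g : T -> R) : measurable_fun setT f ->
  (forall x, 0 <= f x <= g x) -> m.-integrable setT (EFin \o g) ->
  m.-integrable setT (EFin \o f).
Proof.
move=> mf fg; apply: le_integrable => //; first exact/measurable_EFinP.
move=> x _; have /andP[f0 fgx] := fg x.
by rewrite /= lee_fin ger0_norm// (le_trans fgx)// ler_norm.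
Qed.

Lemma ge0_integrable_EFinP (f : T -> R) : measurable_fun setT f -> (forall x, 0 <= f x) ->
  m.-integrable setT (EFin \o f) <-> (\int[m]_x (f x)%:E < +oo)%E.
Proof.
move=> mf f0; have normf : (\int[m]_x `|(EFin \o f) x| = \int[m]_x (f x)%:E)%E.
  by apply: eq_integral => x _; rewrite /= ger0_norm.
split=> [/integrableP[_]|fy]; first by rewrite normf.
by apply/integrableP; split; [exact/measurable_EFinP|rewrite normf].
Qed.

Lemma measurable_expRN (f : T -> R) : measurable_fun setT f ->
  measurable_fun setT (fun x => expR (- f x)).
Proof. by move=> mf; do 2 apply: measurableT_comp => //. Qed.

Section positive_functions.
Variables phi om : T -> R.
Hypotheses (mphi : measurable_fun setT phi) (mom : measurable_fun setT om).
Hypotheses (phi_ge0 : forall x, 0 <= phi x) (om_ge0 : forall x, 0 <= om x).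
Hypothesis iphiom : m.-integrable setT (EFin \o (fun x => phi x * om x)).

Let damped_quotient (p : nat) x := phi x * (p.+1%:R * (1 - expR (- (p.+1%:R^-1 * om x)))).

Let damped_quotient_bound p x : 0 <= damped_quotient p x <= phi x * om x.
Proof.
have om' : 0 <= p.+1%:R^-1 * om x by rewrite mulr_ge0// invr_ge0.
have /andP[_ le_om] := onem_expRN_bounds om'.
rewrite /damped_quotient !mulr_ge0 ?onem_expRN_ge0//= ler_wpM2l//.
by rewrite -[leRHS](@mulVKf _ p.+1%:R) ?pnatr_eq0// ler_wpM2l.
Qed.

Let measurable_onem_expRN (a : R) : measurable_fun setT (fun x => 1 - expR (- (a * om x))).
Proof. by apply: measurable_funB => //; apply: measurable_expRN; exact: measurable_funM. Qed.

Let measurable_damped_quotient p : measurable_fun setT (damped_quotient p).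
Proof. by do 2 apply: measurable_funM => //. Qed.

Lemma cvg_Rintegral_onem_expRN :
  p.+1%:R * Rintegral m setT (fun x => phi x * (1 - expR (- (p.+1%:R^-1 * om x))))
    @[p --> \oo] --> Rintegral m setT (fun x => phi x * om x).
Proof.
have idq p : m.-integrable setT (EFin \o damped_quotient p).
  exact: le_ge0_integrable (damped_quotient_bound p) iphiom.
have -> : (fun p : nat => p.+1%:R *
     Rintegral m setT (fun x => phi x * (1 - expR (- (p.+1%:R^-1 * om x))))) =
   (fun p => Rintegral m setT (damped_quotient p)).
  apply/funext => p; apply: (canLR (@mulVKf _ _ _)); first by rewrite pnatr_eq0.
  rewrite -RintegralZl//; last exact: idq.
  apply: eq_Rintegral => x _.
  by rewrite mulrCA mulKf ?pnatr_eq0.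
apply: fine_cvg; rewrite fineK; last exact: integrable_fin_num.
have := @dominated_convergence _ _ _ m setT measurableT
  (fun p x => (damped_quotient p x)%:E) (fun x => (phi x * om x)%:E)
  (fun x => (phi x * om x)%:E).
case=> //.
- by move=> p; exact/measurable_EFinP.
- exact/measurable_EFinP/measurable_funM.
- apply: aeW => x _; apply: cvg_EFin; first exact: nearW.
  apply: cvgM; first exact: cvg_cst.
  apply: cvg_onem_expRN => [p|]; first by rewrite mulr_ge0// invr_ge0.
  rewrite (_ : (fun _ => _) = fun=> om x); first exact: cvg_cst.
  by apply/funext => p; rewrite mulVKf ?pnatr_eq0.
- apply: aeW => x p _; have /andP[? ?] := damped_quotient_bound p x.
  by rewrite /= lee_fin ger0_norm.
Qed.

Lemma decay_rate_Rintegral : m.-integrable setT (EFin \o phi) ->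
  decay_rate (fun s => Rintegral m setT (fun x => phi x * expR (- (s * om x))))
             (Rintegral m setT (fun x => phi x * om x)).
Proof.
move=> iphi; rewrite /decay_rate (_ : decrement_quotient _ = (fun p : nat => p.+1%:R *
    Rintegral m setT (fun x => phi x * (1 - expR (- (p.+1%:R^-1 * om x)))))).
  exact: cvg_Rintegral_onem_expRN.
apply/funext => p; rewrite /decrement_quotient; congr (_ * _).
under [X in X - _ = _]eq_Rintegral do rewrite mul0r oppr0 expR0 mulr1.
rewrite -RintegralB//; first by apply: eq_Rintegral => x _; ring.
apply: le_ge0_integrable iphi; first exact/measurable_funM/measurable_expRN/measurable_funM.
move=> x; rewrite mulr_ge0 ?expR_ge0//= ler_piMr// expRN_le1//.
by rewrite mulr_ge0// invr_ge0.
Qed.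

End positive_functions.
End integral_decay_rate.

Lemma bounded_ge0_integrable (R : realType) d (T : measurableType d)
    (m : {finite_measure set T -> \bar R}) (f : T -> R) (C : R) :
  measurable_fun setT f -> (forall x, 0 <= f x <= C) ->
  m.-integrable setT (EFin \o f).
Proof.
move=> mf fC; apply: (le_ge0_integrable (g := cst C)) => //.
exact: finite_measure_integrable_cst.
Qed.

(** * Set partitions *)

Fixpoint adjoins (T : Type) (k : T) (r : seq (seq T)) : seq (seq (seq T)) :=
  if r is b :: r' then ((k :: b) :: r') :: [seq b :: r'' | r'' <- adjoins k r'] else [::].

(* Each set partition of [k :: s] arises once from a set partition of [s], by
   making [k] a block of its own or by adjoining it to one of the blocks. *)
Fixpoint seq_partitions (T : Type) (s : seq T) : seq (seq (seq T)) :=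
  if s is k :: s' then
    flatten [seq ([:: k] :: r) :: adjoins k r | r <- seq_partitions s']
  else [:: [::]].

Lemma big_seq_partitions_cons (R T : Type) (idx : R) (op : Monoid.com_law idx)
    (k : T) (s : seq T) (F : seq (seq T) -> R) :
  \big[op/idx]_(r <- seq_partitions (k :: s)) F r =
  \big[op/idx]_(r <- seq_partitions s)
     op (F ([:: k] :: r)) (\big[op/idx]_(c <- adjoins k r) F c).
Proof.
by rewrite /= big_flatten/= big_map; apply: eq_bigr => r _; rewrite big_cons.
Qed.

Section set_partitions.
Variable T : eqType.
Implicit Types (k : T) (s b : seq T) (r c : seq (seq T)).

Lemma adjoinsP k r c : c \in adjoins k r ->
  exists2 b, b \in r & perm_eq c ((k :: b) :: rem b r).
Proof.
elim: r c => //= b r ih c; rewrite inE => /orP[/eqP ->|/mapP[c' /ih[b' b'r pc'] ->]].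
  by exists b; rewrite ?mem_head// eqxx.
exists b'; first by rewrite inE b'r orbT.
have bC : perm_eq (b :: c') ((k :: b') :: b :: rem b' r).
  by rewrite -(perm_cons b) in pc'; apply: (perm_trans pc'); rewrite (perm_catCA [:: b] [:: _]).
apply: (perm_trans bC); rewrite perm_cons; case: eqP => [->|_] //.
by rewrite perm_sym perm_to_rem.
Qed.

Lemma seq_partitions_consP k s c : c \in seq_partitions (k :: s) ->
  exists2 r, r \in seq_partitions s &
    c = [:: k] :: r \/ exists2 b, b \in r & perm_eq c ((k :: b) :: rem b r).
Proof.
move=> /= /flatten_mapP[r rs]; rewrite inE => /orP[/eqP ->|/adjoinsP cr].
  by exists r => //; left.
by exists r => //; right.
Qed.

Lemma perm_flatten_seq_partitions s r : r \in seq_partitions s -> perm_eq (flatten r) s.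
Proof.
elim: s r => [|k s ih] r; first by rewrite inE => /eqP ->.
move=> /seq_partitions_consP[r' /ih r's [->|[b br' /perm_flatten pr]]].
  by rewrite /= perm_cons.
apply: (perm_trans pr); rewrite /= perm_cons; apply: perm_trans r's.
by rewrite perm_sym; exact: perm_flatten (perm_to_rem br').
Qed.

Lemma size_seq_partitions_gt0 s : (0 < size (seq_partitions s))%N.
Proof. by elim: s => //= k s; case: (seq_partitions s). Qed.

Lemma seq_partitions_neq0 s r b : r \in seq_partitions s -> b \in r -> b != [::].
Proof.
elim: s r b => [|k s ih] r b; first by rewrite inE => /eqP ->.
move=> /seq_partitions_consP[r' r's [->|[b' _ /perm_mem ->]]]; rewrite inE.
  by case/orP=> [/eqP ->//|]; exact: ih.
by case/orP=> [/eqP ->//|/mem_rem]; exact: ih.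
Qed.

End set_partitions.

Lemma adjoins_map (T U : Type) (f : T -> U) (k : T) (r : seq (seq T)) :
  adjoins (f k) (map (map f) r) = map (map (map f)) (adjoins k r).
Proof. by elim: r => //= b r ->; rewrite -!map_comp. Qed.

Lemma seq_partitions_map (T U : Type) (f : T -> U) (s : seq T) :
  seq_partitions (map f s) = map (map (map f)) (seq_partitions s).
Proof.
elim: s => //= k s ->; rewrite map_flatten -!map_comp; congr flatten.
by apply: eq_map => r /=; rewrite adjoins_map.
Qed.

Lemma rem_map (T U : eqType) (f : T -> U) (x : T) (s : seq T) : injective f ->
  rem (f x) (map f s) = map f (rem x s).
Proof. by move=> f_inj; elim: s => //= y s ->; rewrite (inj_eq f_inj); case: eqP. Qed.

Lemma seq_partitions_optionP (T : eqType) (s : seq T) (c : seq (seq (option T))) :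
  c \in seq_partitions (None :: map Some s) ->
  exists2 r, r \in seq_partitions s &
    c = [:: None] :: map (map Some) r \/
    exists2 b, b \in r & perm_eq c ((None :: map Some b) :: map (map Some) (rem b r)).
Proof.
case/seq_partitions_consP=> r'; rewrite seq_partitions_map => /mapP[r rs ->] cP.
exists r => //; case: cP => [->|[_ /mapP[b br ->] cb]]; [by left|right].
by exists b => //; rewrite -(rem_map _ _ (inj_map Some_inj)).
Qed.

(** * Moments from a Laplace functional *)

Section damped_moments.
Context {R : realType} d (T : measurableType d) (m : {measure set T -> \bar R}).
Variables (I : finType) (f : I -> T -> R) (phi : T -> R).
Hypotheses (mf : forall k, measurable_fun setT (f k)) (mphi : measurable_fun setT phi).
Hypotheses (f_ge0 : forall k x, 0 <= f k x) (phi_ge0 : forall x, 0 <= phi x).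
Implicit Types (t : I -> R) (j : I) (b : seq I).

Definition tilt t x : R := phi x * expR (- \sum_k t k * f k x).

Definition tilted_moment t b : R :=
  Rintegral m setT (fun x => \prod_(k <- b) f k x * tilt t x).

Definition tilted_mass_defect t : R := Rintegral m setT (fun x => 1 - tilt t x).

Definition bump t j (s : R) : I -> R := fun k => t k + (k == j)%:R * s.

Lemma bump0 t j : bump t j 0 = t.
Proof. by apply/funext => k; rewrite /bump mulr0 addr0. Qed.

Lemma bump_ge0 t j s : (forall k, 0 <= t k) -> 0 <= s -> forall k, 0 <= bump t j s k.
Proof. by move=> t0 s0 k; rewrite addr_ge0// mulr_ge0. Qed.

Lemma tilt0 x : tilt (fun=> 0) x = phi x.
Proof. by rewrite /tilt big1 ?oppr0 ?expR0 ?mulr1// => k _; rewrite mul0r. Qed.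

Lemma tilt_bump t j s x : tilt (bump t j s) x = tilt t x * expR (- (s * f j x)).
Proof.
rewrite /tilt -mulrA -expRD -opprD; congr (_ * expR (- _)).
under eq_bigr do rewrite mulrDl; rewrite big_split/=; congr (_ + _).
rewrite (bigD1 j)//= eqxx mul1r big1 ?addr0// => k /negbTE ->.
by rewrite !mul0r.
Qed.

Lemma tilt_ge0 t x : 0 <= tilt t x.
Proof. by rewrite mulr_ge0 ?expR_ge0. Qed.

Lemma tilt_le t x : (forall k, 0 <= t k) -> tilt t x <= phi x.
Proof.
by move=> t0; rewrite ler_piMr// expRN_le1// sumr_ge0// => k _; rewrite mulr_ge0.
Qed.

Lemma measurable_tilt t : measurable_fun setT (tilt t).
Proof.
apply: measurable_funM => //; apply: measurable_expRN.
by apply: measurable_sum => k; exact: measurable_funM.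
Qed.

Let prodf_ge0 b x : 0 <= \prod_(k <- b) f k x.
Proof. by apply: prodr_ge0. Qed.

Let measurable_prod_tilt t b :
  measurable_fun setT (fun x => \prod_(k <- b) f k x * tilt t x).
Proof. by apply: measurable_funM; [exact: measurable_prod|exact: measurable_tilt]. Qed.

Definition integrable_moment b :=
  m.-integrable setT (EFin \o (fun x => \prod_(k <- b) f k x * phi x)).

Lemma integrable_tilted_moment t b : (forall k, 0 <= t k) -> integrable_moment b ->
  m.-integrable setT (EFin \o (fun x => \prod_(k <- b) f k x * tilt t x)).
Proof.
move=> t0; apply: le_ge0_integrable => // x.
by rewrite mulr_ge0 ?tilt_ge0//= ler_wpM2l// tilt_le.
Qed.

Lemma decay_rate_tilted_moment t j b : (forall k, 0 <= t k) ->
  integrable_moment b -> integrable_moment (j :: b) ->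
  decay_rate (fun s => tilted_moment (bump t j s) b) (tilted_moment t (j :: b)).
Proof.
move=> t0 ib ijb; pose prod_tilt x := \prod_(k <- b) f k x * tilt t x.
have prod_tilt_cons x : \prod_(k <- j :: b) f k x * tilt t x = prod_tilt x * f j x.
  by rewrite big_cons -mulrA mulrC.
rewrite /tilted_moment; under eq_Rintegral do rewrite prod_tilt_cons.
apply: (@eq_decay_rate _
  (fun s => Rintegral m setT (fun x => prod_tilt x * expR (- (s * f j x))))) => [s _|].
  by apply: eq_Rintegral => x _; rewrite tilt_bump mulrA.
apply: decay_rate_Rintegral => //.
- exact: measurable_prod_tilt.
- by move=> x; exact: mulr_ge0 (prodf_ge0 b x) (tilt_ge0 t x).
- by under eq_fun do rewrite -prod_tilt_cons; exact: integrable_tilted_moment.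
- exact: integrable_tilted_moment.
Qed.

Hypothesis integrable_mass_defect : forall t, (forall k, 0 <= t k) ->
  m.-integrable setT (EFin \o (fun x => 1 - tilt t x)).

Let mass_defect_bump t j s : (forall k, 0 <= t k) -> 0 <= s ->
  tilted_mass_defect (bump t j s) - tilted_mass_defect t =
  Rintegral m setT (fun x => tilt t x * (1 - expR (- (s * f j x)))).
Proof.
move=> t0 s0.
rewrite -RintegralB//; [|exact/integrable_mass_defect/bump_ge0|exact: integrable_mass_defect].
by apply: eq_Rintegral => x _; rewrite tilt_bump; ring.
Qed.

Lemma le_mass_defect_bump t j s : (forall k, 0 <= t k) -> 0 <= s ->
  tilted_mass_defect t <= tilted_mass_defect (bump t j s).
Proof.
move=> t0 s0; rewrite -subr_ge0 mass_defect_bump//; apply: Rintegral_ge0 => x _.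
by rewrite mulr_ge0 ?tilt_ge0 ?onem_expRN_ge0 ?mulr_ge0.
Qed.

Lemma decay_rate_mass_defect t j : (forall k, 0 <= t k) -> integrable_moment [:: j] ->
  decay_rate (fun s => tilted_mass_defect (bump t j s)) (- tilted_moment t [:: j]).
Proof.
move=> t0 ij; rewrite /decay_rate (_ : decrement_quotient _ = - (fun p : nat => p.+1%:R *
    Rintegral m setT (fun x => tilt t x * (1 - expR (- (p.+1%:R^-1 * f j x)))))).
  apply: cvgN; rewrite /tilted_moment.
  under eq_Rintegral do rewrite big_seq1 mulrC.
  apply: cvg_Rintegral_onem_expRN => //; [exact: measurable_tilt|exact: tilt_ge0|].
  have := integrable_tilted_moment t0 ij.
  by under eq_fun do rewrite big_seq1 mulrC.
apply/funext => p; rewrite /decrement_quotient bump0 opprfctE -mulrN.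
by rewrite -mass_defect_bump ?invr_ge0// opprB.
Qed.

End damped_moments.

Section moment_formula.
Context {R : realType} dO (O : measurableType dO) (P : {measure set O -> \bar R})
  dL (L : measurableType dL) (nu : {measure set L -> \bar R}).
Variables (I : finType) (theta : R).
Variables (S : I -> O -> R) (phi : O -> R) (om : I -> L -> R) (psi : L -> R).
Hypothesis theta_ge0 : 0 <= theta.
Hypotheses (mS : forall k, measurable_fun setT (S k)) (mphi : measurable_fun setT phi).
Hypotheses (mom : forall k, measurable_fun setT (om k)) (mpsi : measurable_fun setT psi).
Hypotheses (S_ge0 : forall k w, 0 <= S k w) (phi_ge0 : forall w, 0 <= phi w).
Hypotheses (om_ge0 : forall k x, 0 <= om k x) (psi_ge0 : forall x, 0 <= psi x).
Hypothesis integrable_S : forall b, integrable_moment P S phi b.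
Hypothesis integrable_om : forall b, b != [::] -> integrable_moment nu om psi b.
Hypothesis integrable_defect : forall t, (forall k, 0 <= t k) ->
  nu.-integrable setT (EFin \o (fun x => 1 - tilt om psi t x)).

Let laplace t : R := expR (- (theta * tilted_mass_defect nu om psi t)).

Hypothesis laplaceE : forall t, (forall k, 0 <= t k) ->
  Rintegral P setT (tilt S phi t) = laplace t.

Let block t b : R := theta * tilted_moment nu om psi t b.

Let decay_rate_laplace t j : (forall k, 0 <= t k) ->
  decay_rate (fun s => laplace (bump t j s)) (block t [:: j] * laplace t).
Proof.
move=> t0; rewrite -[in X in _ * X](bump0 t j) /laplace.
apply: (@decay_rate_expRN R (fun s => theta * tilted_mass_defect nu om psi (bump t j s))).
  by move=> s s0; rewrite bump0 ler_wpM2l// le_mass_defect_bump.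
by rewrite -mulrN; apply: decay_rateZ; apply: decay_rate_mass_defect => //; exact: integrable_om.
Qed.

Let decay_rate_blocks t j r : (forall k, 0 <= t k) -> {in r, forall b, b != [::]} ->
  decay_rate (fun s => \prod_(b <- r) block (bump t j s) b)
     (\sum_(c <- adjoins j r) \prod_(b <- c) block t b).
Proof.
move=> t0; elim: r => [_|b r ih r_neq0] /=.
  by under eq_fun do rewrite big_nil; rewrite big_nil; exact: decay_rate_cst.
have b0 : b != [::] by rewrite r_neq0// mem_head.
have r0 : {in r, forall b, b != [::]} by move=> c cr; rewrite r_neq0// inE cr orbT.
under eq_fun do rewrite big_cons.
rewrite big_cons big_map big_cons; under [X in _ + X]eq_bigr do rewrite big_cons.
rewrite -big_distrr/= -[X in _ + block X b * _](bump0 t j).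
rewrite -[X in _ * \prod_(c <- r) block X c + _](bump0 t j).
apply: decay_rateM (ih r0); apply: decay_rateZ.
by apply: decay_rate_tilted_moment => //; exact: integrable_om.
Qed.

(* Differentiating at a block either multiplies by a new singleton block (when
   the exponential is differentiated) or adjoins the item to a block. *)
Lemma tilted_moment_formula t s : (forall k, 0 <= t k) ->
  tilted_moment P S phi t s =
  laplace t * \sum_(r <- seq_partitions s) \prod_(b <- r) block t b.
Proof.
elim: s t => [|j s ih] t t0.
  rewrite /= big_seq1 big_nil mulr1 -laplaceE//; apply: eq_Rintegral => w _.
  by rewrite big_nil mul1r.
have lhs : decay_rate (fun s' => tilted_moment P S phi (bump t j s') s)
    (tilted_moment P S phi t (j :: s)) by exact: decay_rate_tilted_moment.
have rhs : decay_rate (fun s' => laplace (bump t j s') *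
      \sum_(r <- seq_partitions s) \prod_(b <- r) block (bump t j s') b)
    (block t [:: j] * laplace t *
      (\sum_(r <- seq_partitions s) \prod_(b <- r) block (bump t j 0) b) +
     laplace (bump t j 0) *
      \sum_(r <- seq_partitions s) \sum_(c <- adjoins j r) \prod_(b <- c) block t b).
  apply: decay_rateM; first exact: decay_rate_laplace.
  apply: decay_rate_sum => r rs; apply: decay_rate_blocks => // b.
  exact: seq_partitions_neq0 rs.
rewrite bump0 in rhs.
have {}lhs := eq_decay_rate (fun s' s'0 => ih (bump t j s') (bump_ge0 j t0 s'0)) lhs.
rewrite (decay_rate_unique lhs rhs) big_seq_partitions_cons big_split/=.
under [in RHS]eq_bigr do rewrite big_cons.
by rewrite -big_distrr/=; ring.
Qed.

Lemma moment_formula s :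
  Rintegral P setT (fun w => \prod_(k <- s) S k w * phi w) =
  expR (- (theta * Rintegral nu setT (fun x => 1 - psi x))) *
  \sum_(r <- seq_partitions s) \prod_(b <- r)
    (theta * Rintegral nu setT (fun x => \prod_(k <- b) om k x * psi x)).
Proof.
have := @tilted_moment_formula (fun=> 0) s (fun=> lexx 0).
rewrite /laplace /block /tilted_moment /tilted_mass_defect.
under eq_Rintegral do rewrite tilt0; move=> ->.
under eq_Rintegral do rewrite tilt0.
by under eq_bigr do under eq_bigr do under eq_Rintegral do rewrite tilt0.
Qed.

End moment_formula.

(** * Densities and independence *)

Section density_measure.
Context {R : realType} d (T : measurableType d) (m : {measure set T -> \bar R}).
Variable f : T -> \bar R.

Definition density_measure & measurable_fun setT f & (forall x, 0 <= f x)%E :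
  set T -> \bar R := fun A => (\int[m]_(x in A) f x)%E.

Variables (mf : measurable_fun setT f) (f_ge0 : forall x, (0 <= f x)%E).
Local Notation nu := (density_measure mf f_ge0).

Let density_measure0 : nu set0 = 0%E.
Proof. exact: integral_set0. Qed.

Let density_measure_ge0 A : (0 <= nu A)%E.
Proof. exact: integral_ge0. Qed.

Let density_measure_sigma_additive : semi_sigma_additive nu.
Proof.
move=> F mF tF mUF; rewrite /density_measure ge0_integral_bigcup//.
  apply: is_cvg_ereal_nneg_natsum_cond => n _ _; exact: integral_ge0.
exact: measurable_funTS.
Qed.

HB.instance Definition _ := isMeasure.Build _ _ _ nu
  density_measure0 density_measure_ge0 density_measure_sigma_additive.

Import HBNNSimple.

Let integral_density_nnsfun (h : {nnsfun T >-> R}) :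
  (\int[nu]_x (h x)%:E = \int[m]_x (f x * (h x)%:E))%E.
Proof.
have mh y : measurable (h @^-1` [set y]) by exact: measurable_funPTI.
pose level y x := (\1_(h @^-1` [set y]) x)%:E : \bar R.
have mlevel y : measurable_fun setT (level y).
  by apply/measurable_EFinP; exact: measurable_indic.
transitivity (\int[nu]_x (\sum_(y \in range h) (y%:E * level y x)))%E.
  by apply: eq_integral => x _; rewrite fimfunE -fsumEFin.
transitivity (\int[m]_x (\sum_(y \in range h) (y%:E * (f x * level y x))))%E; last first.
  apply: eq_integral => x _; rewrite [in RHS]fimfunE -fsumEFin// ge0_mule_fsumr.
    by apply: eq_fsbigr => y _; rewrite EFinM muleCA.
  by move=> y; rewrite EFinM nnfun_muleindic_ge0.
rewrite !ge0_integral_fsum//.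
- apply: eq_fsbigr => y; rewrite inE => -[x _ <-{y}].
  rewrite !ge0_integralZl//.
  + rewrite integral_indic// setIT; congr (_ * _)%E.
    by rewrite /= /density_measure integral_mkcond epatch_indic.
  + exact: emeasurable_funM.
  + by move=> z _; rewrite mule_ge0// lee_fin.
  + by rewrite lee_fin.
  + by move=> z _; rewrite lee_fin.
  + by rewrite lee_fin.
- by move=> y; apply: measurable_funeM; exact: emeasurable_funM.
- move=> y x _; rewrite muleCA mule_ge0//; exact: nnfun_muleindic_ge0.
- by move=> y; exact: measurable_funeM.
- by move=> y x _; exact: nnfun_muleindic_ge0.
Qed.

Lemma ge0_integral_density (g : T -> \bar R) : (forall x, f x \is a fin_num) ->
  measurable_fun setT g -> (forall x, 0 <= g x)%E ->
  (\int[nu]_x g x = \int[m]_x (f x * g x))%E.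
Proof.
move=> f_fin mg g_ge0; pose h := nnsfun_approx measurableT mg.
have h_cvg x : (EFin \o h ^~ x) @ \oo --> g x by exact: cvg_nnsfun_approx.
have h_nd x : {homo (h ^~ x) : i j / (i <= j)%N >-> i <= j}.
  by move=> i j ij; exact/lefP/nd_nnsfun_approx.
have mh n : measurable_fun setT (EFin \o h n) by exact/measurable_EFinP.
transitivity (limn (fun n => \int[nu]_x (h n x)%:E))%E.
  rewrite -monotone_convergence//=.
  - by apply: eq_integral => x _; apply/esym/cvg_lim => //; exact: h_cvg.
  - by move=> n x _; rewrite lee_fin.
  - by move=> x _ i j ij; rewrite lee_fin; exact: h_nd.
under eq_fun do rewrite integral_density_nnsfun.
rewrite -monotone_convergence//=.
- by apply: eq_integral => x _; apply/cvg_lim => //; apply: cvgeZl => //; exact: h_cvg.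
- by move=> n; exact: emeasurable_funM mf (mh n).
- by move=> n x _; rewrite mule_ge0// lee_fin.
- by move=> x _ i j ij; rewrite lee_wpmul2l// lee_fin; exact: h_nd.
Qed.

End density_measure.

Lemma ge0_integral_weighted_pushforward (R : realType) dS (S : measurableType dS)
    dT (T : measurableType dT) (P : {measure set S -> \bar R}) (m : {measure set T -> \bar R})
    (W : S -> R) (V : S -> T) (f : T -> \bar R) :
  measurable_fun setT W -> (forall w, 0 <= W w) -> measurable_fun setT V ->
  (forall B, measurable B -> (\int[P]_(w in V @^-1` B) (W w)%:E = m B)%E) ->
  measurable_fun setT f -> (forall x, 0 <= f x)%E ->
  (\int[P]_w ((W w)%:E * f (V w)) = \int[m]_x f x)%E.
Proof.
move=> mW W_ge0 mV WV mf f_ge0.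
have mEW : measurable_fun setT (EFin \o W) by exact/measurable_EFinP.
have EW_ge0 w : (0 <= (EFin \o W) w)%E by rewrite lee_fin.
transitivity (\int[pushforward (density_measure P mEW EW_ge0) V]_y f y)%E.
  rewrite (ge0_integral_pushforward mV)// preimage_setT ge0_integral_density//.
    exact: measurableT_comp.
  by move=> x; exact: f_ge0.
by apply: eq_measure_integral => B mB _; exact: WV.
Qed.

Lemma prod_indic_bigcap (R : pzRingType) (T : Type) (I : eqType) (s : seq I)
    (A : I -> set T) (x : T) :
  \prod_(i <- s) \1_(A i) x = \1_(\bigcap_(i in [set i | i \in s]) A i) x :> R.
Proof.
elim: s => [|j s ih].
  by rewrite big_nil indicE mem_set// => i /=; rewrite in_nil.
have -> : \bigcap_(i in [set i | i \in j :: s]) A i =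
    A j `&` \bigcap_(i in [set i | i \in s]) A i.
  apply/seteqP; split=> [y Ay|y [Ajy Asy] i /=].
    by split=> [|i /= is']; apply: Ay; rewrite /= inE ?eqxx ?is' ?orbT.
  by rewrite inE => /orP[/eqP ->//|]; exact: Asy.
by rewrite big_cons ih indicI.
Qed.

Section independence.
Context {R : realType} dS (S : measurableType dS) (P : probability S R)
  dT (T : measurableType dT) (I : eqType) (V : I -> S -> T).
Hypothesis mV : forall i, measurable_fun setT (V i).

Lemma integral_weight_comp (W : S -> R) (U : S -> T) (a : R) (h : T -> R) :
  measurable_fun setT W -> (forall w, 0 <= W w) -> measurable_fun setT U -> 0 <= a ->
  (forall A, measurable A -> (\int[P]_(w in U @^-1` A) (W w)%:E = a%:E * P (U @^-1` A))%E) ->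
  measurable_fun setT h -> (forall x, 0 <= h x) ->
  (\int[P]_w (W w * h (U w))%:E = a%:E * \int[P]_w (h (U w))%:E)%E.
Proof.
move=> mW W_ge0 mU a_ge0 WU mh h_ge0.
pose law := mscale (NngNum a_ge0) (pushforward P U).
have mEh : measurable_fun setT (EFin \o h) by exact/measurable_EFinP.
have Eh_ge0 x : (0 <= (EFin \o h) x)%E by rewrite lee_fin.
transitivity (\int[P]_w ((W w)%:E * (EFin \o h) (U w)))%E => //.
rewrite (ge0_integral_weighted_pushforward (m := law mU) mW W_ge0 mU _ mEh Eh_ge0)//.
by rewrite ge0_integral_mscale// (ge0_integral_pushforward mU).
Qed.

Definition indep_weight (W : S -> R) (c : R) (s : seq I) :=
  forall B : I -> set T, (forall i, measurable (B i)) ->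
  (\int[P]_w (W w * \prod_(i <- s) \1_(B i) (V i w))%:E =
   c%:E * \prod_(i <- s) P (V i @^-1` B i))%E.

(* A factor that is no longer an indicator is absorbed in the weight. *)
Lemma indep_weight_cons (W : S -> R) (c : R) (j : I) (s : seq I) (h : T -> R) :
  j \notin s -> measurable_fun setT W -> (forall w, 0 <= W w) -> 0 <= c ->
  measurable_fun setT h -> (forall x, 0 <= h x <= 1) ->
  indep_weight W c (j :: s) ->
  indep_weight (fun w => W w * h (V j w)) (c * fine (\int[P]_w (h (V j w))%:E)) s.
Proof.
move=> js mW W_ge0 c_ge0 mh h01 indep B mB.
have h_ge0 x : 0 <= h x by have /andP[] := h01 x.
pose Wprod w := W w * \prod_(i <- s) \1_(B i) (V i w).
pose p := \prod_(i <- s) fine (P (V i @^-1` B i)).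
have pE : (\prod_(i <- s) P (V i @^-1` B i) = p%:E)%E.
  rewrite -prodEFin; apply: eq_bigr => i _; rewrite fineK// fin_num_measure//.
  exact: measurable_preimageT.
have p_ge0 : 0 <= p by apply: prodr_ge0 => i _; exact: fine_ge0.
have hE : (\int[P]_w (h (V j w))%:E)%E \is a fin_num.
  apply: integrable_fin_num => //; apply: (@bounded_ge0_integrable _ _ _ P (h \o V j) 1).
    exact: measurableT_comp.
  by move=> w; exact: h01.
rewrite pE EFinM fineK// muleAC -EFinM -(integral_weight_comp (W := Wprod) _ _ (mV j))//.
- by apply: eq_integral => w _; rewrite mulrAC.
- apply: measurable_funM => //; apply: measurable_prod => i _.
  by apply: measurableT_comp => //; exact: measurable_indic.
- by move=> w; rewrite mulr_ge0// prodr_ge0.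
- exact: mulr_ge0.
move=> A mA; pose B' i := if i == j then A else B i.
have mB' i : measurable (B' i) by rewrite /B'; case: ifP.
have B'E i : i \in s -> B' i = B i.
  by rewrite /B' => is'; case: eqP js => // <-; rewrite is'.
have B'j : B' j = A by rewrite /B' eqxx.
have := indep B' mB'; rewrite big_cons B'j.
rewrite (eq_big_seq (fun i => P (V i @^-1` B i))) => [|i /B'E ->//].
rewrite pE muleCA -EFinM muleC => indepB'.
rewrite -indepB' integral_mkcond.
apply: eq_integral => w _; rewrite epatch_indic/= -EFinM /Wprod big_cons B'j.
rewrite [in RHS](eq_big_seq (fun i => \1_(B i) (V i w))) => [|i /B'E ->//].
by rewrite mulrCA mulrC !indicE.
Qed.

Lemma integral_weight_prod_independent (s : seq I) (W : S -> R) (c : R) (f : I -> T -> R) :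
  uniq s -> measurable_fun setT W -> (forall w, 0 <= W w) -> 0 <= c ->
  indep_weight W c s ->
  (forall i, measurable_fun setT (f i)) -> (forall i x, 0 <= f i x <= 1) ->
  (\int[P]_w (W w * \prod_(i <- s) f i (V i w))%:E =
   c%:E * \prod_(i <- s) \int[P]_w (f i (V i w))%:E)%E.
Proof.
move=> + + + + + mf f01; elim: s W c => [|j s ih] W c.
  move=> _ _ _ _ /(_ (fun=> setT) (fun=> measurableT)); rewrite !big_nil => <-.
  by apply: eq_integral => w _; rewrite !big_nil.
rewrite /= => /andP[js us] mW W_ge0 c_ge0 indep.
have f_ge0 i x : 0 <= f i x by have /andP[] := f01 i x.
have mfV i : measurable_fun setT (f i \o V i) by exact: measurableT_comp.
pose fj := fine (\int[P]_w (f j (V j w))%:E).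
have fjE : (\int[P]_w (f j (V j w))%:E = fj%:E)%E.
  rewrite fineK//; apply: integrable_fin_num => //.
  by apply: (@bounded_ge0_integrable _ _ _ P (f j \o V j) 1) => // w; exact: f01.
transitivity (\int[P]_w ((W w * f j (V j w)) * \prod_(i <- s) f i (V i w))%:E)%E.
  by apply: eq_integral => w _; rewrite big_cons mulrA.
rewrite (ih (fun w => W w * f j (V j w)) (c * fj))//.
- by rewrite big_cons fjE EFinM muleA.
- exact: measurable_funM mW (mfV j).
- by move=> w; rewrite mulr_ge0.
- by rewrite mulr_ge0// fine_ge0// integral_ge0// => w _; rewrite lee_fin.
- exact: indep_weight_cons.
Qed.

Lemma integral_prod_independent (s : seq I) (f : I -> T -> R) : uniq s ->
  (forall B : I -> set T, (forall i, measurable (B i)) ->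
     P (\bigcap_(i in [set i | i \in s]) (V i @^-1` B i)) =
     (\prod_(i <- s) P (V i @^-1` B i))%E) ->
  (forall i, measurable_fun setT (f i)) -> (forall i x, 0 <= f i x <= 1) ->
  (\int[P]_w (\prod_(i <- s) f i (V i w))%:E =
   \prod_(i <- s) \int[P]_w (f i (V i w))%:E)%E.
Proof.
move=> us indep mf f01; rewrite -[RHS]mul1e.
rewrite -(@integral_weight_prod_independent s (cst 1) 1 f us)//.
  by apply: eq_integral => w _; rewrite mul1r.
move=> B mB; rewrite mul1e -indep//.
transitivity (\int[P]_w (\1_(\bigcap_(i in [set i | i \in s]) (V i @^-1` B i)) w)%:E)%E.
  apply: eq_integral => w _; rewrite mul1r.
  by rewrite -(prod_indic_bigcap R s (fun i => V i @^-1` B i)).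
rewrite integral_indic ?setIT//; apply: fin_bigcap_measurable => [|i _].
  exact: finite_seq.
exact: measurable_preimageT.
Qed.

End independence.

Section product_integral.
Context {R : realType} d1 d2 (T1 : measurableType d1) (T2 : measurableType d2)
  (m1 : {sigma_finite_measure set T1 -> \bar R}).

Lemma ge0_integral_prodM (m2 : {sigma_finite_measure set T2 -> \bar R})
    (f : T1 -> \bar R) (g : T2 -> \bar R) :
  measurable_fun setT f -> measurable_fun setT g ->
  (forall x, 0 <= f x)%E -> (forall y, 0 <= g y)%E ->
  (\int[m1 \x m2]_z (f z.1 * g z.2) = \int[m1]_x f x * \int[m2]_y g y)%E.
Proof.
move=> mf mg f_ge0 g_ge0; rewrite (fubini_tonelli1 (fun z => f z.1 * g z.2)%E).
- rewrite -ge0_integralZr//; last exact: integral_ge0.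
  by apply: eq_integral => x _; rewrite -ge0_integralZl.
- by apply: emeasurable_funM; apply: measurableT_comp.
- by move=> z; exact: mule_ge0.
Qed.

Lemma ge0_integral_prod_fst (Q : probability T2 R) (f : T1 -> \bar R) :
  measurable_fun setT f -> (forall x, 0 <= f x)%E ->
  (\int[m1 \x Q]_z f z.1 = \int[m1]_x f x)%E.
Proof.
move=> mf f_ge0; have := @ge0_integral_prodM Q f (cst 1%E) mf (measurable_cst _) f_ge0
  (fun=> lee01).
rewrite integral_cst// [X in (_ * (_ * X))%E]probability_setT !mule1 => <-.
by apply: eq_integral => z _; rewrite mule1.
Qed.

Lemma ge0_integrable_fst (Q : probability T2 R) (f : T1 -> R) :
  (forall x, 0 <= f x) -> m1.-integrable setT (EFin \o f) ->
  (m1 \x Q)%E.-integrable setT (EFin \o (f \o fst)).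
Proof.
move=> f_ge0 fint; have mf := measurable_int _ fint.
have mf' : measurable_fun setT f by exact/measurable_EFinP.
apply/ge0_integrable_EFinP; [exact: measurableT_comp|by move=> x /=|].
apply: (@le_lt_trans _ _ (\int[m1]_x (f x)%:E)%E); last exact/ge0_integrable_EFinP.
by rewrite -(@ge0_integral_prod_fst Q (EFin \o f))// => x; rewrite lee_fin.
Qed.

End product_integral.

Section exponential_bounds.
Context {R : realType}.

Lemma onem_expRN_le_min (C q y : R) : 0 <= C -> 0 <= q -> 0 <= y -> y <= C * q ->
  1 - expR (- y) <= (1 + C) * Num.min 1 q.
Proof.
move=> C0 q0 y0 yCq; have /andP[_ le_y] := onem_expRN_bounds y0.
have e0 := expR_ge0 (- y).
by have [q1|q1] := leP 1 q; nra.
Qed.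

Lemma expr_expRN_bounded (N : nat) (c : R) : 0 < c ->
  exists2 C : R, 0 <= C & forall x, 0 <= x -> x ^+ N * expR (- (c * x)) <= C.
Proof.
move=> c0; case: N => [|N].
  by exists 1 => // x x0; rewrite expr0 mul1r expRN_le1// mulr_ge0// ltW.
pose a := c / N.+1%:R; have a0 : 0 < a by rewrite divr_gt0.
exists (a^-1 ^+ N.+1) => [|x x0]; first by rewrite exprn_ge0// invr_ge0 ltW.
have -> : expR (- (c * x)) = expR (- (a * x)) ^+ N.+1.
  by rewrite -expRM_natl; congr expR; rewrite /a; field; rewrite addrC natr1 pnatr_eq0.
rewrite -exprMn lerXn2r ?nnegrE ?mulr_ge0 ?expR_ge0 ?invr_ge0 ?(ltW a0)//.
rewrite expRN ler_pdivrMr ?expR_gt0// ler_pdivlMl//.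
by apply: le_trans (expR_ge1Dx _); rewrite lerDr.
Qed.

Lemma expr_expRN_le_min (N : nat) (c : R) : 0 < c ->
  exists2 C : R, 0 <= C &
    forall x, 0 <= x -> x ^+ N.+1 * expR (- (c * x)) <= C * Num.min 1 x.
Proof.
move=> c0; have [C1 C1_ge0 bound1] := expr_expRN_bounded N.+1 c0.
have [C2 C2_ge0 bound2] := expr_expRN_bounded N c0.
exists (C1 + C2) => [|x x0]; first exact: addr_ge0.
have [x1|x1] := leP 1 x; first by have := bound1 x x0; rewrite mulr1; lra.
by rewrite exprS -mulrA mulrC ler_wpM2r//; have := bound2 x x0; lra.
Qed.

Lemma prodr_le_expr (I : Type) (b : seq I) (f : I -> R) (M : R) :
  (forall k, 0 <= f k <= M) -> \prod_(k <- b) f k <= M ^+ size b.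
Proof.
move=> fM; have f_ge0 k : 0 <= f k by have /andP[] := fM k.
elim: b => [|k b ih]; first by rewrite big_nil expr0.
by rewrite big_cons exprS ler_pM// ?prodr_ge0//; have /andP[] := fM k.
Qed.

End exponential_bounds.

Section atoms.
Context {R : realType} d (Z : measurableType d) (I : finType) (E : I -> set Z).
Hypothesis mE : forall k, measurable (E k).

Definition pattern (z : Z) : {set I} := [set k | z \in E k].

Definition atom (K : {set I}) : set Z := [set z | pattern z = K].

Lemma measurable_atom K : measurable (atom K).
Proof.
rewrite (_ : atom K = \bigcap_(k in [set: I]) (if k \in K then E k else ~` E k)).
  by apply: fin_bigcap_measurable => // k _; case: ifP => // _; exact: measurableC.
apply/seteqP; split=> [z <- k _|z zK].
  by rewrite inE; case: ifPn => [/set_mem//|/negP zEk /mem_set].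
apply/setP => k; rewrite inE; have := zK k Logic.I.
by case: ifPn => _ => [/mem_set ->//|zEk]; apply/negbTE/negP => /set_mem.
Qed.

Lemma atomI K L : K <> L -> atom K `&` atom L = set0.
Proof. by move=> KL; apply/seteqP; split=> // z [zK zL]; apply: KL; rewrite -zK -zL. Qed.

Lemma ge0_integral_pattern (m : {measure set Z -> \bar R}) (h : {set I} -> R) :
  (forall K, 0 <= h K) ->
  (\int[m]_z (h (pattern z))%:E = \sum_(K : {set I}) (h K)%:E * m (atom K))%E.
Proof.
move=> h_ge0; pose h1 K z : \bar R := ((h K)%:E * (\1_(atom K) z)%:E)%E.
transitivity (\int[m]_z (\sum_(K : {set I}) h1 K z))%E.
  apply: eq_integral => z _; rewrite (bigD1 (pattern z))//= big1 ?adde0.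
    by rewrite /h1 indicE mem_set// mule1.
  by move=> K /eqP Kz; rewrite /h1 indicE memNset ?mule0// => zK; apply: Kz.
have m1 K : measurable_fun setT (fun z => (\1_(atom K) z)%:E : \bar R).
  by apply/measurable_EFinP/measurable_indic; exact: measurable_atom.
rewrite ge0_integral_sum//.
- apply: eq_bigr => K _; rewrite ge0_integralZl//; last by rewrite lee_fin.
  by rewrite integral_indic ?setIT//; exact: measurable_atom.
- by move=> K; exact: measurable_funeM.
- by move=> K z _; rewrite mule_ge0// lee_fin.
Qed.

(* On the atom [K], the function [\sum_(k | Q k) t k * \1_(E k)] is constant. *)
Definition atom_coef (t : I -> R) (Q : pred I) (K : {set I}) : R :=
  \sum_(k in K | Q k) t k.

Lemma atom_coef_ge0 t Q K : (forall k, 0 <= t k) -> 0 <= atom_coef t Q K.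
Proof. by move=> t0; exact: sumr_ge0. Qed.

Lemma atom_coef_pattern t Q z :
  atom_coef t Q (pattern z) = \sum_(k | Q k) t k * \1_(E k) z.
Proof.
rewrite /atom_coef big_mkcondl; apply: eq_bigr => k _; rewrite inE indicE.
by case: (_ \in _); rewrite ?mulr1 ?mulr0.
Qed.

Lemma sum_measure_atoms (m : {measure set Z -> \bar R}) (t : I -> R) (Q : pred I) :
  (forall k, 0 <= t k) ->
  (\sum_(k | Q k) (t k)%:E * m (E k) =
   \sum_(K : {set I}) (atom_coef t Q K)%:E * m (atom K))%E.
Proof.
move=> t0; have m1 k : measurable_fun setT (fun z => (\1_(E k) z)%:E : \bar R).
  exact/measurable_EFinP/measurable_indic.
rewrite -ge0_integral_pattern; last by move=> K; exact: atom_coef_ge0.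
under [RHS]eq_integral do rewrite atom_coef_pattern -sumEFin -big_filter.
rewrite -[LHS]big_filter ge0_integral_sum//.
- apply: eq_bigr => k _; under [RHS]eq_integral do rewrite EFinM.
  rewrite ge0_integralZl//; last by rewrite lee_fin.
  by rewrite integral_indic// setIT.
- by move=> k; apply/measurable_EFinP; exact: measurable_funM.
- by move=> k z _; rewrite lee_fin mulr_ge0.
Qed.

End atoms.

Lemma measurable_invr_ge0 (R : realType) d (T : measurableType d) (f : T -> R) :
  measurable_fun setT f -> (forall x, 0 <= f x) -> measurable_fun setT (fun x => (f x)^-1).
Proof.
move=> mf f_ge0; rewrite (_ : (fun x => _) = (@powR R ^~ (-1)) \o f).
  exact: measurableT_comp.
by apply/funext => x; rewrite /= powR_inv1.
Qed.

(** * Normalisation *)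

Section tail_integral.
Context {R : realType}.
Local Notation leb := (@lebesgue_measure R).

Definition tail_integral (w : R -> \bar R) (u : R) : \bar R :=
  (\int[leb]_(s in `]0%R, +oo[) w (u + s)%R)%E.

Lemma tail_integral_ge0 w u : (forall x, 0 <= w x)%E -> (0 <= tail_integral w u)%E.
Proof. by move=> w_ge0; exact: integral_ge0. Qed.

Lemma iter_tail_integral_ge0 n w u : (forall x, 0 <= w x)%E ->
  (0 <= iter n tail_integral w u)%E.
Proof. by move=> w_ge0; elim: n u => //= n ih u; exact: tail_integral_ge0. Qed.

Lemma measurable_iter_tail_integral d (V : measurableType d) n
    (w : measurableTypeR R * V -> \bar R) :
  measurable_fun setT w -> (forall y, 0 <= w y)%E ->
  measurable_fun setT (fun y => iter n tail_integral (fun u => w (u, y.2)) y.1).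
Proof.
move=> mw w_ge0; elim: n => [|n ih]/=.
  by under eq_fun do rewrite -surjective_pairing.
under eq_fun do rewrite /tail_integral integral_mkcond epatch_indic.
apply: (@measurable_fun_fubini_tonelli_F _ _ _ _ _ leb
  (fun z : (measurableTypeR R * V) * measurableTypeR R =>
     iter n tail_integral (fun u => w (u, z.1.2)) (z.1.1 + z.2)%R *
     (\1_`]0%R, +oo[ z.2)%:E)%E).
  apply: emeasurable_funM.
    have mshift : measurable_fun setT
        (fun z : (measurableTypeR R * V) * measurableTypeR R => (z.1.1 + z.2, z.1.2)).
      apply: measurable_fun_pair; last exact: measurableT_comp.
      by apply: measurable_funD => //; exact: measurableT_comp.
    exact: (measurableT_comp ih mshift).
  apply/measurable_EFinP; apply: (measurableT_comp _ measurable_snd).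
  exact: measurable_indic.
by move=> z; rewrite mule_ge0 ?lee_fin// iter_tail_integral_ge0.
Qed.

Lemma measurable_iter_tail_integral1 n (w : R -> \bar R) :
  measurable_fun setT w -> (forall u, 0 <= w u)%E ->
  measurable_fun setT (iter n tail_integral w).
Proof.
move=> mw w_ge0.
have mw' := @measurable_iter_tail_integral _ (measurableTypeR R) n (w \o fst)
  (measurableT_comp mw measurable_fst) (fun y => w_ge0 y.1).
have mpair : measurable_fun setT (fun u : measurableTypeR R => (u, 0 : measurableTypeR R)).
  exact: measurable_fun_pair.
exact: (measurableT_comp mw' mpair).
Qed.

Lemma tail_integral_sum (I : Type) (s : seq I) (g : I -> \bar R) (w : I -> R -> \bar R) u :
  (forall i, 0 <= g i)%E -> (forall i, measurable_fun setT (w i)) ->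
  (forall i x, 0 <= w i x)%E ->
  (tail_integral (fun u => \sum_(i <- s) g i * w i u) u =
   \sum_(i <- s) g i * tail_integral (w i) u)%E.
Proof.
move=> g_ge0 mw w_ge0; rewrite /tail_integral.
have mw' i : measurable_fun setT (fun v : measurableTypeR R => w i (u + v)).
  by apply: measurableT_comp => //; exact: measurable_funD.
rewrite ge0_integral_sum//.
- by apply: eq_bigr => i _; rewrite ge0_integralZl//; exact: measurable_funTS.
- by move=> i; apply: measurable_funTS; exact: measurable_funeM.
- by move=> i v _; rewrite mule_ge0.
Qed.

Lemma integral_expRN_itv (a : R) : 0 < a ->
  (\int[leb]_(s in `]0%R, +oo[) (expR (- (a * s)))%:E = (a^-1)%:E)%E.
Proof.
move=> a0.
have mexp : measurable_fun setT (fun s => (expR (- (a * s)))%:E).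
  by apply/measurable_EFinP; apply: measurable_expRN; exact: measurable_funM.
rewrite integral_itv_obnd_cbnd; last exact: measurable_funTS.
have := integral_exponential_pdf a0.
have -> : (\int[leb]_s (exponential_pdf a s)%:E =
    \int[leb]_(s in `[0%R, +oo[) (a%:E * (expR (- (a * s)))%:E))%E.
  rewrite [RHS]integral_mkcond; apply: eq_integral => s _.
  by rewrite /exponential_pdf !patchE mulNr; case: ifP.
rewrite ge0_integralZl// ?lee_fin ?ltW//; last exact: measurable_funTS.
move=> /(congr1 (fun y => (a^-1)%:E * y)%E).
by rewrite muleA -EFinM mulVf ?gt_eqF// mul1e mule1.
Qed.

Lemma integral_expRN_shift (c a u : R) : 0 <= c -> 0 < a ->
  (\int[leb]_(s in `]0%R, +oo[) (c * expR (- ((u + s) * a)))%:E =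
   (c / a * expR (- (u * a)))%:E)%E.
Proof.
move=> c_ge0 a_gt0; have expD s : (c * expR (- ((u + s) * a)))%:E =
    ((c * expR (- (u * a)))%:E * (expR (- (a * s)))%:E)%E.
  by rewrite -EFinM -mulrA -expRD; congr (_ * expR _)%:E; ring.
under eq_integral do rewrite expD.
rewrite ge0_integralZl//.
- by rewrite integral_expRN_itv// -EFinM mulrAC.
- by apply/measurable_EFinP/measurable_funTS/measurable_expRN; exact: measurable_funM.
- by rewrite lee_fin mulr_ge0 ?expR_ge0.
Qed.

End tail_integral.

Section inverse_powers.
Context {R : realType} dO (Omega : measurableType dO)
  (P : {sigma_finite_measure set Omega -> \bar R}).
Variable T : Omega -> R.
Hypotheses (mT : measurable_fun setT T) (T_ge0 : forall w, 0 <= T w).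
Hypothesis T_gt0 : {ae P, forall w, 0 < T w}.
Implicit Types W : Omega -> R.
Local Notation leb := (@lebesgue_measure R).

Lemma integral_inv_tail W (F : R -> \bar R) (u : R) :
  measurable_fun setT W -> (forall w, 0 <= W w) -> 0 <= u ->
  (forall v, 0 < v -> (\int[P]_w (W w * expR (- (v * T w)))%:E)%E = F v) ->
  (\int[P]_w (W w / T w * expR (- (u * T w)))%:E = tail_integral F u)%E.
Proof.
move=> mW W_ge0 u0 WF.
pose k (y : Omega * measurableTypeR R) := ((W y.1 * expR (- ((u + y.2) * T y.1)))%:E *
  (\1_(`]0%R, +oo[%classic : set R) y.2)%:E)%E.
have k_ge0 y : (0 <= k y)%E by rewrite mule_ge0// lee_fin mulr_ge0 ?expR_ge0.
have mWexp v : measurable_fun setT (fun w => W w * expR (- (v * T w))).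
  by apply: measurable_funM => //; apply: measurable_expRN; exact: measurable_funM.
have mk : measurable_fun setT k.
  apply: emeasurable_funM; last first.
    apply/measurable_EFinP; apply: (measurableT_comp _ measurable_snd).
    exact: measurable_indic.
  apply/measurable_EFinP; apply: measurable_funM; first exact: measurableT_comp.
  apply: measurable_expRN; apply: measurable_funM; last exact: measurableT_comp.
  exact: measurable_funD.
transitivity (\int[P]_w \int[leb]_s k (w, s))%E.
  apply: ae_eq_integral => //.
  - apply/measurable_EFinP; apply: measurable_funM; last first.
      by apply: measurable_expRN; exact: measurable_funM.
    by apply: measurable_funM => //; exact: measurable_invr_ge0.
  - exact: (@measurable_fun_fubini_tonelli_F _ _ _ _ _ leb k mk k_ge0).
  apply: filterS T_gt0 => w Tw _.
  by rewrite -integral_expRN_shift// integral_mkcond epatch_indic.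
rewrite (fubini_tonelli k)// /tail_integral [RHS]integral_mkcond.
apply: eq_integral => s _; rewrite patchE /k/=.
case: ifPn; rewrite ?inE ?notin_setE => s0.
  rewrite -WF; last by move: s0; rewrite /= in_itv/= andbT => s0; rewrite ltr_wpDl.
  by apply: eq_integral => w _; rewrite indicE mem_set// mule1.
by rewrite integral0_eq// => w _; rewrite indicE memNset// mule0.
Qed.

Lemma integral_inv_power_mixture (I : Type) (s : seq I) (g : I -> \bar R)
    (w : I -> R -> \bar R) W (n : nat) :
  measurable_fun setT W -> (forall o, 0 <= W o) -> (forall i, 0 <= g i)%E ->
  (forall i, measurable_fun setT (w i)) -> (forall i u, 0 <= w i u)%E ->
  (forall u, 0 < u -> (\int[P]_o (W o * expR (- (u * T o)))%:E)%E =
     (\sum_(i <- s) g i * w i u)%E) ->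
  (\int[P]_o (W o / T o ^+ n.+1)%:E =
   \sum_(i <- s) g i * iter n.+1 tail_integral (w i) 0%R)%E.
Proof.
move=> mW W_ge0 g_ge0 mw w_ge0 W_mixture.
have mWT k : measurable_fun setT (fun o => W o / T o ^+ k).
  apply: measurable_funM => //; apply: measurable_invr_ge0 => [|o].
    exact: measurable_funX.
  exact: exprn_ge0.
have WT_ge0 k o : 0 <= W o / T o ^+ k by rewrite divr_ge0 ?exprn_ge0.
have inv_power_succ k u : 0 <= u ->
    (forall v, 0 < v -> (\int[P]_o (W o / T o ^+ k * expR (- (v * T o)))%:E)%E =
       (\sum_(i <- s) g i * iter k tail_integral (w i) v)%E) ->
    (\int[P]_o (W o / T o ^+ k.+1 * expR (- (u * T o)))%:E =
       \sum_(i <- s) g i * iter k.+1 tail_integral (w i) u)%E.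
  move=> u0 /(integral_inv_tail (mWT k) (WT_ge0 k) u0).
  rewrite tail_integral_sum//.
  - by move=> <-; apply: eq_integral => o _; rewrite exprSr invfM mulrA.
  - by move=> i; exact: measurable_iter_tail_integral1.
  - by move=> i x; exact: iter_tail_integral_ge0.
have inv_power k v : 0 < v -> (\int[P]_o (W o / T o ^+ k * expR (- (v * T o)))%:E)%E =
    (\sum_(i <- s) g i * iter k tail_integral (w i) v)%E.
  elim: k v => [|k ih] v v0; last by apply: inv_power_succ ih; exact: ltW.
  by rewrite -W_mixture//; apply: eq_integral => o _; rewrite expr0 divr1.
rewrite -inv_power_succ//; first by apply: eq_integral => o _; rewrite mul0r oppr0 expR0 mulr1.
exact: inv_power.
Qed.

End inverse_powers.

(** * Completely random vectors *)

Section expmE.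
Context {R : realType}.
Implicit Types x y : \bar R.

Lemma expmED x y : (0 <= x)%E -> (0 <= y)%E -> expmE (x + y)%E = expmE x * expmE y.
Proof.
by case: x y => [x| |] [y| |]//= _ _; rewrite ?mulr0 ?mul0r// opprD expRD.
Qed.

Lemma expmE_sum (I : Type) (s : seq I) (f : I -> \bar R) :
  (forall i, (0 <= f i)%E) -> expmE (\sum_(i <- s) f i)%E = \prod_(i <- s) expmE (f i).
Proof.
move=> f_ge0; elim: s => [|i s ih]; first by rewrite !big_nil /= oppr0 expR0.
by rewrite !big_cons expmED// ?ih//; apply: sume_ge0.
Qed.

Lemma expmE_ge0_le1 x : (0 <= x)%E -> 0 <= expmE x <= 1.
Proof.
case: x => [x| |]//=; rewrite ?lexx ?ler01// lee_fin => x0.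
by rewrite expR_ge0 expRN_le1.
Qed.

Lemma measurable_expmE : measurable_fun setT (@expmE R).
Proof.
rewrite (_ : @expmE R = (fun x => if x \is a fin_num then expR (- fine x) else 0)).
  apply: measurable_fun_ifT => //; last exact: measurable_expRN.
  apply: (measurable_fun_bool true) => /=.
  have := emeasurable_fin_num measurableT (@measurable_id _ (\bar R) setT).
  by rewrite setTI.
by apply/funext => -[x| |].
Qed.

End expmE.

Section completely_random_vector.
Context {R : realType} dZ (Z : measurableType dZ) (G0 : probability Z R)
  dS (S : measurableType dS) (rho : {sigma_finite_measure set S -> \bar R}).
Variables (theta : R) (jump : bool -> S -> R).
Hypothesis theta_ge0 : 0 <= theta.
Hypotheses (mjump : forall e, measurable_fun setT (jump e))
  (jump_ge0 : forall e s, 0 <= jump e s).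
Hypothesis levy : rho.-integrable setT
  (EFin \o (fun s => Num.min 1 (jump true s + jump false s))).

Definition damping (x : R * R) (s : S) : R := x.1 * jump true s + x.2 * jump false s.

Definition levy_exponent (x : R * R) : R :=
  Rintegral rho setT (fun s => 1 - expR (- damping x s)).

Lemma measurable_damping x : measurable_fun setT (damping x).
Proof. by apply: measurable_funD; exact: measurable_funM. Qed.

Lemma damping_ge0 x s : 0 <= x.1 -> 0 <= x.2 -> 0 <= damping x s.
Proof. by move=> x1 x2; rewrite addr_ge0// mulr_ge0. Qed.

Let jump_size_ge0 s : 0 <= jump true s + jump false s.
Proof. exact: addr_ge0. Qed.

Let min_jump_ge0 s : 0 <= Num.min 1 (jump true s + jump false s).
Proof. by rewrite le_min ler01 jump_size_ge0. Qed.

Lemma jump_le_size e s : jump e s <= jump true s + jump false s.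
Proof. by case: e; rewrite ?lerDl ?lerDr. Qed.

Lemma integrable_onem_expRN_jumps (C : R) (f : S * Z -> R) : 0 <= C ->
  measurable_fun setT f ->
  (forall x, 0 <= f x <= C * (jump true x.1 + jump false x.1)) ->
  (rho \x G0)%E.-integrable setT (EFin \o (fun x => 1 - expR (- f x))).
Proof.
move=> C0 mf fC.
have := integrableZl measurableT (1 + C) (ge0_integrable_fst G0 min_jump_ge0 levy).
apply: le_ge0_integrable; first exact/measurable_funB/measurable_expRN.
move=> x; have /andP[f0 fCx] := fC x.
by rewrite onem_expRN_ge0//= onem_expRN_le_min.
Qed.

Lemma integrable_levy_exponent x : 0 <= x.1 -> 0 <= x.2 ->
  rho.-integrable setT (EFin \o (fun s => 1 - expR (- damping x s))).
Proof.
move=> x1 x2; have := integrableZl measurableT (1 + (x.1 + x.2)) levy.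
apply: le_ge0_integrable.
  exact/measurable_funB/measurable_expRN/measurable_damping.
move=> s; rewrite onem_expRN_ge0 ?damping_ge0//=.
rewrite onem_expRN_le_min ?damping_ge0 ?addr_ge0//.
by rewrite mulrDl lerD// ler_wpM2l// jump_le_size.
Qed.

Lemma levy_exponentE x : 0 <= x.1 -> 0 <= x.2 ->
  (\int[rho]_s (1 - expR (- damping x s))%:E)%E = (levy_exponent x)%:E.
Proof.
move=> x1 x2; rewrite fineK//; apply: integrable_fin_num => //.
exact: integrable_levy_exponent.
Qed.

Variables (dO : measure_display) (Omega : measurableType dO) (P : probability Omega R).
Variable mu : bool -> Omega -> {measure set Z -> \bar R}.
Hypothesis mmu : forall e A, measurable A -> measurable_fun setT (fun w => mu e w A).
Hypothesis indep_mu : forall (N : nat) (A : nat -> set Z) (B : nat -> set (\bar R * \bar R)%type),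
  (forall i, (i < N)%N -> measurable (A i) /\ measurable (B i)) ->
  (forall i j, (i < N)%N -> (j < N)%N -> i <> j -> A i `&` A j = set0) ->
  P (\bigcap_(i in `I_N) [set w | B i (mu true w (A i), mu false w (A i))]) =
  (\prod_(i < N) P [set w | B i (mu true w (A i), mu false w (A i))])%E.
Hypothesis laplace_mu : forall (A : set Z) (x : R * R),
  measurable A -> 0 <= x.1 -> 0 <= x.2 ->
  (\int[P]_w (expmE (x.1%:E * mu true w A + x.2%:E * mu false w A)%E)%:E)%E =
  (expR (- (theta * fine (G0 A) * levy_exponent x)))%:E.

Lemma indep_mu_seq (J : eqType) (s : seq J) (C : J -> set Z)
    (B : J -> set (\bar R * \bar R)) :
  uniq s -> (forall p, measurable (C p)) -> (forall p q, p <> q -> C p `&` C q = set0) ->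
  (forall p, measurable (B p)) ->
  P (\bigcap_(p in [set p | p \in s]) [set w | B p (mu true w (C p), mu false w (C p))]) =
  (\prod_(p <- s) P [set w | B p (mu true w (C p), mu false w (C p))])%E.
Proof.
move=> us mC Cdisj mB; case: s us => [|p0 s'] us.
  rewrite big_nil -(@probability_setT _ _ _ P); congr (P _).
  by apply/seteqP; split.
set s := p0 :: s' in us *; rewrite (big_nth p0) big_mkord.
rewrite -(indep_mu (A := fun i => C (nth p0 s i)) (B := fun i => B (nth p0 s i)))//.
  congr (P _); apply/seteqP; split=> [w Bw i /= si|w Bw p /= /(nthP p0)[i si <-]].
    exact/Bw/mem_nth.
  exact: Bw.
by move=> i j si sj ij; apply: Cdisj => /eqP; rewrite nth_uniq// => /eqP.
Qed.

Lemma laplace_disjoint (J : eqType) (s : seq J) (C : J -> set Z) (x : J -> R * R) :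
  uniq s -> (forall p, measurable (C p)) -> (forall p q, p <> q -> C p `&` C q = set0) ->
  (forall p, 0 <= (x p).1) -> (forall p, 0 <= (x p).2) ->
  (\int[P]_w (\prod_(p <- s)
      expmE ((x p).1%:E * mu true w (C p) + (x p).2%:E * mu false w (C p))%E)%:E)%E =
  (expR (- (theta * \sum_(p <- s) fine (G0 (C p)) * levy_exponent (x p))))%:E.
Proof.
move=> us mC Cdisj x1 x2.
pose V p w := (mu true w (C p), mu false w (C p)).
(* Norms make the factors functions of arbitrary pairs with values in [0, 1]. *)
pose f p (y : \bar R * \bar R) : R := expmE ((x p).1%:E * `|y.1| + (x p).2%:E * `|y.2|)%E.
have fV p w : f p (V p w) =
    expmE ((x p).1%:E * mu true w (C p) + (x p).2%:E * mu false w (C p))%E.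
  by rewrite /f /V/= !gee0_abs.
under eq_integral do under eq_bigr do rewrite -fV.
rewrite (integral_prod_independent (V := V))//.
- transitivity (\prod_(p <- s) (expR (- (theta * fine (G0 (C p)) * levy_exponent (x p))))%:E)%E.
    by apply: eq_bigr => p _; under eq_integral do rewrite fV; exact: laplace_mu.
  rewrite prodEFin -expR_sum sumrN mulr_sumr.
  by under eq_bigr do rewrite -mulrA.
- by move=> p; apply: measurable_fun_pair; exact: mmu.
- by move=> B mB; exact: indep_mu_seq.
- move=> p; apply: measurableT_comp; first exact: measurable_expmE.
  by apply: emeasurable_funD; apply: measurable_funeM; apply: measurableT_comp.
- by move=> p y; apply: expmE_ge0_le1; rewrite adde_ge0// mule_ge0// ?lee_fin ?abse_ge0.
Qed.

Section items.
Variables (I : finType) (e : I -> bool) (E : I -> set Z).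
Hypothesis mE : forall k, measurable (E k).

Definition item_jump (k : I) (x : S * Z) : R := jump (e k) x.1 * \1_(E k) x.2.

Lemma item_jump_ge0 k x : 0 <= item_jump k x.
Proof. exact: mulr_ge0. Qed.

Lemma measurable_item_jump k : measurable_fun setT (item_jump k).
Proof.
apply: measurable_funM; first exact: measurableT_comp.
by apply: measurableT_comp => //; exact: measurable_indic.
Qed.

Variable t : I -> R.
Hypothesis t_ge0 : forall k, 0 <= t k.

Let energy x := \sum_k t k * item_jump k x.

Let measurable_energy : measurable_fun setT energy.
Proof.
by apply: measurable_sum => k; apply: measurable_funM => //; exact: measurable_item_jump.
Qed.

Let energy_bounds x : 0 <= energy x <= (\sum_k t k) * (jump true x.1 + jump false x.1).
Proof.
rewrite sumr_ge0/= => [|k _]; last by rewrite mulr_ge0 ?item_jump_ge0.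
rewrite mulr_suml ler_sum// => k _; rewrite ler_wpM2l//.
apply: le_trans (jump_le_size (e k) x.1).
by rewrite /item_jump ler_piMr// indicE lern1 leq_b1.
Qed.

Lemma integrable_laplace_items :
  (rho \x G0)%E.-integrable setT (EFin \o (fun x => 1 - expR (- energy x))).
Proof.
by apply: integrable_onem_expRN_jumps energy_bounds => //; exact: sumr_ge0.
Qed.

Let coef (K : {set I}) : R * R := (atom_coef t e K, atom_coef t (predC e) K).

Let energy_pattern s z : energy (s, z) = damping (coef (pattern E z)) s.
Proof.
rewrite /energy (bigID e)/= /damping/= !atom_coef_pattern.
by rewrite !mulr_suml; congr (_ + _); apply: eq_bigr => k ek;
  rewrite /item_jump/= ?ek ?(negbTE ek) -mulrA; congr (_ * _); rewrite mulrC.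
Qed.

Let total_energy_atoms w :
  (\sum_k (t k)%:E * mu (e k) w (E k) = \sum_(K : {set I})
     ((coef K).1%:E * mu true w (atom E K) + (coef K).2%:E * mu false w (atom E K)))%E.
Proof.
rewrite big_split/= -!sum_measure_atoms// (bigID e)/=; congr (_ + _)%E.
  by apply: eq_bigr => k ->.
by apply: eq_bigr => k /negbTE ->.
Qed.

Let Rintegral_energy :
  Rintegral (rho \x G0)%E setT (fun x => 1 - expR (- energy x)) =
  \sum_(K : {set I}) fine (G0 (atom E K)) * levy_exponent (coef K).
Proof.
have coef1 K : 0 <= (coef K).1 by exact: atom_coef_ge0.
have coef2 K : 0 <= (coef K).2 by exact: atom_coef_ge0.
have onem_ge0 K s : 0 <= 1 - expR (- damping (coef K) s).
  by rewrite onem_expRN_ge0// damping_ge0.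
have monem K : measurable_fun setT (fun s => 1 - expR (- damping (coef K) s)).
  exact/measurable_funB/measurable_expRN/measurable_damping.
have G0E K : G0 (atom E K) = (fine (G0 (atom E K)))%:E.
  by rewrite fineK// fin_num_measure//; exact: measurable_atom.
apply: EFin_inj; rewrite -sumEFin /Rintegral fineK; last first.
  exact: integrable_fin_num integrable_laplace_items.
rewrite (fubini_tonelli1 (fun x => (1 - expR (- energy x))%:E)); last 2 first.
- exact/measurable_EFinP/measurable_funB/measurable_expRN.
- by move=> x; have /andP[? _] := energy_bounds x; rewrite lee_fin onem_expRN_ge0.
transitivity (\int[rho]_s (\sum_(K : {set I})
    (fine (G0 (atom E K)))%:E * (1 - expR (- damping (coef K) s))%:E))%E.
  apply: eq_integral => s _; rewrite /fubini_F.
  under eq_integral do rewrite energy_pattern.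
  rewrite (ge0_integral_pattern mE G0 (fun K => onem_ge0 K s)).
  by apply: eq_bigr => K _; rewrite muleC; congr (_ * _)%E; exact: G0E.
rewrite ge0_integral_sum//.
- apply: eq_bigr => K _; rewrite ge0_integralZl ?lee_fin ?fine_ge0//.
  + by rewrite levy_exponentE.
  + exact/measurable_EFinP.
  + by move=> s _; rewrite lee_fin.
- by move=> K; apply: measurable_funeM; exact/measurable_EFinP.
- by move=> K s _; rewrite mule_ge0// lee_fin// fine_ge0.
Qed.

Lemma laplace_items :
  (\int[P]_w (expmE (\sum_k (t k)%:E * mu (e k) w (E k))%E)%:E)%E =
  (expR (- (theta * Rintegral (rho \x G0)%E setT
     (fun x => 1 - expR (- \sum_k t k * item_jump k x)))))%:E.
Proof.
rewrite Rintegral_energy -laplace_disjoint//.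
- apply: eq_integral => w _; rewrite total_energy_atoms expmE_sum// => K.
  by rewrite adde_ge0// mule_ge0// lee_fin atom_coef_ge0.
- exact: index_enum_uniq.
- exact: measurable_atom.
- exact: atomI.
- by move=> K; exact: atom_coef_ge0.
- by move=> K; exact: atom_coef_ge0.
Qed.

End items.

Hypothesis mass_ae : {ae P, forall w, forall e, (0 < mu e w setT < +oo)%E}.

Definition total e w : R := fine (mu e w setT).
Definition share e w (A : set Z) : R := fine (mu e w A) / total e w.

Lemma total_ge0 e w : 0 <= total e w. Proof. exact: fine_ge0. Qed.

Lemma fin_num_mu e w A : measurable A -> (mu e w setT < +oo)%E -> mu e w A \is a fin_num.
Proof.
move=> mA Ty; rewrite ge0_fin_numE//; apply: le_lt_trans Ty.
by apply: le_measure; rewrite ?inE.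
Qed.

Lemma share_ge0_le1 e w A : measurable A -> 0 <= share e w A <= 1.
Proof.
move=> mA; rewrite divr_ge0 ?fine_ge0//=.
have [T0|T0] := eqVneq (total e w) 0; first by rewrite /share T0 invr0 mulr0 ler01.
have Ty : (mu e w setT < +oo)%E.
  by rewrite ltey; apply: contraNneq T0 => Ty; rewrite /total Ty.
rewrite ler_pdivrMr ?lt_neqAle ?total_ge0 1?eq_sym ?T0// mul1r.
by rewrite fine_le ?fin_num_mu//; apply: le_measure; rewrite ?inE.
Qed.

Lemma share_total e w A : measurable A -> (0 < mu e w setT < +oo)%E ->
  mu e w A = (share e w A * total e w)%:E.
Proof.
move=> mA /andP[T0 Ty]; rewrite divfK ?fineK ?fin_num_mu//.
by rewrite gt_eqF// fine_gt0// T0.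
Qed.

Lemma measurable_total e : measurable_fun setT (total e).
Proof. by apply: measurableT_comp => //; exact: mmu. Qed.

Lemma measurable_share e A : measurable A -> measurable_fun setT (fun w => share e w A).
Proof.
move=> mA; apply: measurable_funM; first by apply: measurableT_comp => //; exact: mmu.
by apply: measurable_invr_ge0; [exact: measurable_total|exact: total_ge0].
Qed.

Lemma prod_damped_le (I : Type) (b : seq I) (f : I -> R) (v : bool -> R) (x : R * R) :
  (forall e, 0 <= v e) -> (forall k, 0 <= f k <= v true + v false) ->
  \prod_(k <- b) f k * expR (- (x.1 * v true + x.2 * v false)) <=
  (v true + v false) ^+ size b * expR (- (Num.min x.1 x.2 * (v true + v false))).
Proof.
move=> v_ge0 fv; rewrite ler_pM ?expR_ge0 ?prodr_le_expr//.
  by apply: prodr_ge0 => k _; have /andP[] := fv k.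
by rewrite ler_expR lerN2 mulrDr lerD// ler_wpM2r// ge_min lexx ?orbT.
Qed.

Section mixed_moment.
Variables (I : finType) (e : I -> bool).

Definition jump_moment (b : seq I) (x : R * R) : R :=
  Rintegral rho setT (fun s => \prod_(k <- b) jump (e k) s * expR (- damping x s)).

Lemma integrable_jump_moment b x : 0 < x.1 -> 0 < x.2 -> b != [::] ->
  rho.-integrable setT
    (EFin \o (fun s => \prod_(k <- b) jump (e k) s * expR (- damping x s))).
Proof.
move=> x1 x2; case: b => // k0 b _.
have c0 : 0 < Num.min x.1 x.2 by rewrite lt_min x1.
have [C C0 bound] := expr_expRN_le_min (size b) c0.
have := integrableZl measurableT C levy; apply: le_ge0_integrable.
  apply: measurable_funM; first exact: measurable_prod.
  exact/measurable_expRN/measurable_damping.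
move=> s; rewrite mulr_ge0 ?expR_ge0 ?prodr_ge0//=.
apply: le_trans (bound _ (jump_size_ge0 s)).
apply: (@prod_damped_le _ (k0 :: b) (fun k => jump (e k) s) (jump ^~ s)) => // k.
by rewrite jump_ge0 jump_le_size.
Qed.

Definition partition_weight (r : seq (seq I)) (x : R * R) : R :=
  expR (- (theta * levy_exponent x)) * \prod_(b <- r) (theta * jump_moment b x).

Variable E : I -> set Z.
Hypothesis mE : forall k, measurable (E k).

Definition block_event (b : seq I) : set Z := \bigcap_(k in [set k | k \in b]) E k.

Lemma measurable_block_event b : measurable (block_event b).
Proof. by apply: fin_bigcap_measurable => // k _; exact: mE. Qed.

Lemma prod_item_jump b y :
  \prod_(k <- b) item_jump e E k y = \prod_(k <- b) jump (e k) y.1 * \1_(block_event b) y.2.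
Proof. by rewrite /block_event -prod_indic_bigcap big_split. Qed.

Let mass k w := share (e k) w (E k) * total (e k) w.

Let mass_bounds k w : 0 <= mass k w <= total true w + total false w.
Proof.
have /andP[s0 s1] := share_ge0_le1 (e k) w (mE k).
rewrite mulr_ge0 ?total_ge0//=; apply: (@le_trans _ _ (total (e k) w)).
  by rewrite ler_piMl ?total_ge0.
by case: (e k); rewrite ?lerDl ?lerDr total_ge0.
Qed.

Let mass_ge0 k w : 0 <= mass k w.
Proof. by have /andP[] := mass_bounds k w. Qed.

Let measurable_mass k : measurable_fun setT (mass k).
Proof. by apply: measurable_funM; [exact: measurable_share|exact: measurable_total]. Qed.

Variable x : R * R.
Hypotheses (x1_gt0 : 0 < x.1) (x2_gt0 : 0 < x.2).

Let phi w := expR (- (x.1 * total true w + x.2 * total false w)).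
Let psi (y : S * Z) := expR (- damping x y.1).

Let measurable_phi : measurable_fun setT phi.
Proof.
apply: measurable_expRN.
by apply: measurable_funD; apply: measurable_funM => //; exact: measurable_total.
Qed.

Let measurable_damping_fst : measurable_fun setT (fun y : S * Z => damping x y.1).
Proof. by apply: measurableT_comp => //; exact: measurable_damping. Qed.

Lemma integrable_mass b : integrable_moment P mass phi b.
Proof.
have c0 : 0 < Num.min x.1 x.2 by rewrite lt_min x1_gt0.
have [C C0 bound] := expr_expRN_bounded (size b) c0.
apply: (@bounded_ge0_integrable _ _ _ P _ C) => [|w].
  by apply: measurable_funM => //; exact: measurable_prod.
rewrite mulr_ge0 ?expR_ge0 ?prodr_ge0//=.
apply: le_trans (bound _ (addr_ge0 (total_ge0 true w) (total_ge0 false w))).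
by apply: (@prod_damped_le _ b (mass ^~ w) (total ^~ w)) => // b'; exact: total_ge0.
Qed.

Let block_integral b : b != [::] ->
  (\int[rho \x G0]_y (\prod_(k <- b) item_jump e E k y * psi y)%:E =
   (jump_moment b x * fine (G0 (block_event b)))%:E)%E.
Proof.
move=> b0; pose f s := (\prod_(k <- b) jump (e k) s * expR (- damping x s))%:E.
transitivity (\int[rho \x G0]_y (f y.1 * (\1_(block_event b) y.2)%:E))%E.
  by apply: eq_integral => y _; rewrite prod_item_jump mulrAC EFinM.
rewrite (ge0_integral_prodM rho G0 (f := f) (g := EFin \o \1_(block_event b))).
- rewrite integral_indic ?setIT//; last exact: measurable_block_event.
  rewrite EFinM !fineK ?fin_num_measure//; first exact: measurable_block_event.
  by apply: integrable_fin_num => //; exact: integrable_jump_moment.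
- apply/measurable_EFinP; apply: measurable_funM; first exact: measurable_prod.
  exact/measurable_expRN/measurable_damping.
- exact/measurable_EFinP/measurable_indic/measurable_block_event.
- by move=> s; rewrite lee_fin mulr_ge0 ?expR_ge0 ?prodr_ge0.
- by move=> z; rewrite lee_fin.
Qed.

Let integrable_block b : b != [::] ->
  integrable_moment (rho \x G0)%E (item_jump e E) psi b.
Proof.
move=> b0; apply/ge0_integrable_EFinP.
- apply: measurable_funM; last exact: measurable_expRN.
  by apply: measurable_prod => k _; exact: measurable_item_jump.
- move=> y; rewrite mulr_ge0 ?expR_ge0// prodr_ge0// => k _; exact: item_jump_ge0.
- by rewrite block_integral// ltry.
Qed.

(* The total masses are treated as two more items, with event [setT] and the
   coordinates of [x] as Laplace variables. *)
Let e_ext (j : I + bool) : bool := match j with inl k => e k | inr b => b end.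
Let E_ext (j : I + bool) : set Z := if j is inl k then E k else setT.
Let t_ext (t : I -> R) (j : I + bool) : R :=
  match j with inl k => t k | inr b => if b then x.1 else x.2 end.

Let measurable_E_ext j : measurable (E_ext j).
Proof. by case: j => [k|b]; [exact: mE|exact: measurableT]. Qed.

Let t_ext_ge0 t : (forall k, 0 <= t k) -> forall j, 0 <= t_ext t j.
Proof. by move=> t0 [k|[]]//=; exact: ltW. Qed.

Let sum_t_ext (t : I -> R) (F : bool -> set Z -> R) :
  \sum_j t_ext t j * F (e_ext j) (E_ext j) =
  \sum_k t k * F (e k) (E k) + (x.1 * F true setT + x.2 * F false setT).
Proof. by rewrite big_sumType/= big_bool. Qed.

Let sum_item_jump t y :
  \sum_j t_ext t j * item_jump e_ext E_ext j y = \sum_k t k * item_jump e E k y + damping x y.1.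
Proof.
rewrite (sum_t_ext t (fun b A => jump b y.1 * \1_A y.2)).
by rewrite /damping !indicE !in_setT !mulr1.
Qed.

Let onem_tilt t y : 1 - tilt (item_jump e E) psi t y =
  1 - expR (- \sum_j t_ext t j * item_jump e_ext E_ext j y).
Proof. by rewrite sum_item_jump /tilt -expRD -opprD [damping _ _ + _]addrC. Qed.

Let integrable_defect t : (forall k, 0 <= t k) ->
  (rho \x G0)%E.-integrable setT (EFin \o (fun y => 1 - tilt (item_jump e E) psi t y)).
Proof.
move=> t0; under eq_fun do rewrite onem_tilt.
exact: (integrable_laplace_items e_ext measurable_E_ext (t_ext_ge0 t0)).
Qed.

Let laplace_mass t : (forall k, 0 <= t k) ->
  Rintegral P setT (tilt mass phi t) =
  expR (- (theta * tilted_mass_defect (rho \x G0)%E (item_jump e E) psi t)).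
Proof.
move=> t0.
have -> : tilted_mass_defect (rho \x G0)%E (item_jump e E) psi t = Rintegral (rho \x G0)%E
    setT (fun y => 1 - expR (- \sum_j t_ext t j * item_jump e_ext E_ext j y)).
  by apply: eq_Rintegral => y _; exact: onem_tilt.
apply: EFin_inj; rewrite -(laplace_items e_ext measurable_E_ext (t_ext_ge0 t0)).
rewrite /Rintegral fineK; last first.
  apply: integrable_fin_num => //; apply: (@bounded_ge0_integrable _ _ _ P _ 1) => [|w].
    exact: measurable_tilt.
  have phi_ge0 v : 0 <= phi v by exact: expR_ge0.
  rewrite tilt_ge0//=; apply: le_trans (tilt_le mass_ge0 phi_ge0 w t0) _.
  by rewrite expRN_le1// addr_ge0// mulr_ge0 ?total_ge0// ltW.
apply: ae_eq_integral => //.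
- exact/measurable_EFinP/measurable_tilt.
- apply/measurable_EFinP; apply: measurableT_comp; first exact: measurable_expmE.
  by apply: emeasurable_sum => k; apply: measurable_funeM; exact: mmu.
have [N [mN N0 NS]] := mass_ae; exists N; split => //.
apply: subset_trans NS; apply: subsetC => w mass_w _.
under [in RHS]eq_bigr do rewrite share_total// -EFinM.
rewrite sumEFin/= (sum_t_ext t (fun b A => share b w A * total b w)).
have totalE b : share b w setT * total b w = total b w.
  by apply: EFin_inj; rewrite -share_total// /total fineK// fin_num_mu//; have /andP[] := mass_w b.
by rewrite !totalE /tilt -expRD -opprD [X in expR (- X)]addrC.
Qed.

Let fin_num_mixed_moment (s : seq I) :
  (\int[P]_w (\prod_(k <- s) mass k w * phi w)%:E)%E \is a fin_num.
Proof. by apply: integrable_fin_num => //; exact: integrable_mass. Qed.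

Lemma mixed_moment (s : seq I) :
  (\int[P]_w (\prod_(k <- s) (share (e k) w (E k) * total (e k) w) *
     expR (- (x.1 * total true w + x.2 * total false w)))%:E)%E =
  (\sum_(r <- seq_partitions s)
     partition_weight r x * \prod_(b <- r) fine (G0 (block_event b)))%:E.
Proof.
rewrite -[LHS](fineK (fin_num_mixed_moment s)); congr EFin.
rewrite [LHS](@moment_formula _ _ _ P _ _ (rho \x G0)%E I theta mass phi (item_jump e E) psi)//.
- rewrite (_ : Rintegral _ _ _ = levy_exponent x); last first.
    congr fine.
    rewrite (@ge0_integral_prod_fst _ _ _ _ _ rho G0 (fun s => (1 - expR (- damping x s))%:E))//.
      exact/measurable_EFinP/measurable_funB/measurable_expRN/measurable_damping.
    by move=> s'; rewrite lee_fin onem_expRN_ge0// damping_ge0// ltW.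
  rewrite mulr_sumr big_seq [RHS]big_seq; apply: eq_bigr => r rs.
  rewrite -mulrA -big_split/=; congr (_ * _).
  rewrite big_seq [RHS]big_seq; apply: eq_bigr => b br.
  by rewrite /Rintegral block_integral ?mulrA// (seq_partitions_neq0 rs).
- exact: measurable_item_jump.
- exact: measurable_expRN.
- by move=> w; exact: expR_ge0.
- exact: item_jump_ge0.
- by move=> y; exact: expR_ge0.
- exact: integrable_mass.
Qed.

End mixed_moment.

Section share_moments.
Variables (I : finType) (e : I -> bool) (s : seq I).
Hypotheses (has_true : has e s) (has_false : has (predC e) s).

(* Laplace variables range over the whole plane, where only their absolute
   values matter: the integrands of the weights are then nonnegative. *)
Let plane : measurableType _ := (measurableTypeR R * measurableTypeR R)%type.
Let abs_pair (y : plane) : R * R := (`|y.1|, `|y.2|).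

Let measurable_expRN_damping :
  measurable_fun setT (fun z : plane * S => expR (- damping (abs_pair z.1) z.2)).
Proof.
have mcoord (f : plane -> R) (b : bool) : measurable_fun setT f ->
    measurable_fun setT (fun z : plane * S => `|f z.1| * jump b z.2).
  move=> mf; apply: measurable_funM; last exact: measurableT_comp.
  by apply: measurableT_comp => //; exact: measurableT_comp.
by apply: measurable_expRN; apply: measurable_funD; apply: mcoord.
Qed.

Let measurable_levy_exponent : measurable_fun setT (fun y => levy_exponent (abs_pair y)).
Proof.
apply: (@measurableT_comp _ _ _ _ _ _ fine) => //.
apply: (measurable_fun_fubini_tonelli_F
  (fun z : plane * S => (1 - expR (- damping (abs_pair z.1) z.2))%:E)).
  exact/measurable_EFinP/measurable_funB.
by move=> z; rewrite lee_fin onem_expRN_ge0// damping_ge0/=.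
Qed.

Let measurable_jump_moment b : measurable_fun setT (fun y => jump_moment e b (abs_pair y)).
Proof.
apply: (@measurableT_comp _ _ _ _ _ _ fine) => //.
apply: (measurable_fun_fubini_tonelli_F (fun z : plane * S =>
  (\prod_(k <- b) jump (e k) z.2 * expR (- damping (abs_pair z.1) z.2))%:E)).
  apply/measurable_EFinP; apply: measurable_funM => //.
  by apply: measurable_prod => k _; exact: measurableT_comp.
by move=> z; rewrite lee_fin mulr_ge0 ?expR_ge0// prodr_ge0.
Qed.

Let jump_moment_ge0 b x : 0 <= jump_moment e b x.
Proof. by apply: Rintegral_ge0 => y _; rewrite mulr_ge0 ?expR_ge0// prodr_ge0. Qed.

Let weight (r : seq (seq I)) (y : plane) : \bar R := (partition_weight e r (abs_pair y))%:E.

Let weight_ge0 r y : (0 <= weight r y)%E.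
Proof.
by rewrite lee_fin mulr_ge0 ?expR_ge0// prodr_ge0// => b _; exact: mulr_ge0.
Qed.

Let measurable_weight r : measurable_fun setT (weight r).
Proof.
apply/measurable_EFinP; apply: measurable_funM.
  by apply: measurable_expRN; exact: measurable_funM.
by apply: measurable_prod => b _; exact: measurable_funM.
Qed.

Let n1 := (count e s).-1.
Let n2 := (count (predC e) s).-1.

Let half_normalised r (v : R) : \bar R :=
  iter n1.+1 tail_integral (fun u => weight r (u, v)) 0.

Let half_normalised_ge0 r v : (0 <= half_normalised r v)%E.
Proof. exact: iter_tail_integral_ge0. Qed.

Let measurable_half_normalised r : measurable_fun setT (half_normalised r).
Proof.
have mpair : measurable_fun setT (fun v : measurableTypeR R => (0, v) : plane).
  exact: measurable_fun_pair.
exact: (measurableT_comp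
  (measurable_iter_tail_integral n1.+1 (measurable_weight r) (weight_ge0 r)) mpair).
Qed.

Let normalised r : \bar R := iter n2.+1 tail_integral (half_normalised r) 0.

Let total_gt0 b : {ae P, forall w, 0 < total b w}.
Proof. by apply: filterS mass_ae => w /(_ b) T0; rewrite fine_gt0. Qed.

Let prod_total w :
  \prod_(k <- s) total (e k) w = total true w ^+ n1.+1 * total false w ^+ n2.+1.
Proof.
rewrite !prednK -?has_count//; elim: (s) => [|k s' ih].
  by rewrite big_nil mulr1.
rewrite big_cons ih /=; case: (e k); rewrite /= add1n exprS.
  by rewrite mulrA.
by rewrite mulrCA.
Qed.

Section regions.
Variable E : I -> set Z.
Hypothesis mE : forall k, measurable (E k).

Let masses w := \prod_(k <- s) (share (e k) w (E k) * total (e k) w).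

Let masses_ge0 w : 0 <= masses w.
Proof.
apply: prodr_ge0 => k _; rewrite mulr_ge0 ?total_ge0//.
by have /andP[] := share_ge0_le1 (e k) w (mE k).
Qed.

Let measurable_masses : measurable_fun setT masses.
Proof.
apply: measurable_prod => k _.
by apply: measurable_funM; [exact: measurable_share|exact: measurable_total].
Qed.

Let measurable_inv_total b k : measurable_fun setT (fun w => (total b w ^+ k)^-1).
Proof.
apply: measurable_invr_ge0 => [|w]; last exact/exprn_ge0/total_ge0.
by apply: measurable_funX; exact: measurable_total.
Qed.

Let locations r : \bar R := (\prod_(b <- r) fine (G0 (block_event E b)))%:E.

Let locations_ge0 r : (0 <= locations r)%E.
Proof. by rewrite lee_fin prodr_ge0// => b _; exact: fine_ge0. Qed.

Let sum_half_normalised v : 0 < v ->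
  (\int[P]_w (masses w / total true w ^+ n1.+1 * expR (- (v * total false w)))%:E =
   \sum_(r <- seq_partitions s) locations r * half_normalised r v)%E.
Proof.
move=> v0; rewrite -(integral_inv_power_mixture (measurable_total true) (total_ge0 true)
  (total_gt0 true) (W := fun w => masses w * expR (- (v * total false w))))//.
- by apply: eq_integral => w _; rewrite mulrAC.
- apply: measurable_funM => //; apply: measurable_expRN.
  by apply: measurable_funM => //; exact: measurable_total.
- by move=> w; rewrite mulr_ge0 ?expR_ge0.
- by move=> r; exact: (measurableT_comp (measurable_weight r) (pair2_measurable v)).
move=> u u0; transitivity (\sum_(r <- seq_partitions s)
    partition_weight e r (u, v) * \prod_(b <- r) fine (G0 (block_event E b)))%:E.
  rewrite -(mixed_moment e mE (x := (u, v)))//; apply: eq_integral => w _.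
  by rewrite -mulrA -expRD -opprD [X in expR (- X)]addrC.
rewrite -sumEFin; apply: eq_bigr => r _.
by rewrite /weight /abs_pair/= !gtr0_norm// mulrC EFinM.
Qed.

Lemma share_moment_normalised : (\int[P]_w (\prod_(k <- s) share (e k) w (E k))%:E =
  \sum_(r <- seq_partitions s)
    (\prod_(b <- r) fine (G0 (block_event E b)))%:E * normalised r)%E.
Proof.
rewrite -(integral_inv_power_mixture (measurable_total false) (total_ge0 false)
  (total_gt0 false) (W := fun w => masses w / total true w ^+ n1.+1))//.
- apply: ae_eq_integral => //.
  + by apply/measurable_EFinP; apply: measurable_prod => k _; exact: measurable_share.
  + by apply/measurable_EFinP; apply: measurable_funM => //; exact: measurable_funM.
  apply: filterS2 (total_gt0 true) (total_gt0 false) => w T1 T2 _; congr EFin.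
  rewrite /masses [in RHS]big_split/= prod_total -[RHS]mulrA -invfM mulfK//.
  by rewrite mulf_neq0 ?expf_neq0 ?gt_eqF.
- exact: measurable_funM.
- by move=> w; rewrite divr_ge0 ?exprn_ge0 ?total_ge0.
Qed.

End regions.

Lemma share_moments : exists2 wt : seq (seq I) -> R, (forall r, 0 <= wt r) &
  forall E : I -> set Z, (forall k, measurable (E k)) ->
  (\int[P]_w (\prod_(k <- s) share (e k) w (E k))%:E)%E =
  (\sum_(r <- seq_partitions s) wt r * \prod_(b <- r) fine (G0 (block_event E b)))%:E.
Proof.
have fin_normalised r : r \in seq_partitions s -> normalised r \is a fin_num.
  have := @share_moment_normalised (fun=> setT) (fun=> measurableT).
  under [X in _ = X -> _]eq_bigr => r' _.
    rewrite big1; last first.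
      move=> b _; rewrite (_ : block_event _ b = setT) ?probability_setT//.
      by apply/seteqP; split.
    rewrite mul1e; over.
  move=> sumE; have : (\sum_(r <- seq_partitions s) normalised r)%E \is a fin_num.
    rewrite -sumE; apply: integrable_fin_num => //.
    apply: (@bounded_ge0_integrable _ _ _ P _ 1) => [|w].
      by apply: measurable_prod => k _; exact: measurable_share.
    have share01 k : 0 <= share (e k) w setT <= 1 by exact: share_ge0_le1.
    by rewrite prodr_ge0 ?prodr_ile1// => k _; have /andP[] := share01 k.
  by rewrite sum_fin_num => /allP all_fin rs; apply: all_fin; rewrite map_f ?mem_filter.
exists (fun r => fine (normalised r)).
  by move=> r; rewrite fine_ge0// iter_tail_integral_ge0.
move=> E mE; rewrite share_moment_normalised// -sumEFin big_seq [RHS]big_seq.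
by apply: eq_bigr => r rs; rewrite EFinM fineK ?fin_normalised// muleC.
Qed.

End share_moments.
End completely_random_vector.

(** * Laws of the mixture components *)

Section tuples.
Context d (X : measurableType d) (N : nat).
Implicit Types A : 'I_N -> set X.

Definition box A : set (N.-tuple X) := [set v | forall k, A k (tnth v k)].

Lemma measurable_box A : (forall k, measurable (A k)) -> measurable (box A).
Proof.
move=> mA; rewrite (_ : box A = \bigcap_(k in [set: 'I_N]) ((@tnth N X)^~ k @^-1` A k)).
  apply: fin_bigcap_measurable => // k _.
  exact: measurable_preimageT (measurable_tnth k) _.
by apply/seteqP; split=> [v Av k _|v Av k]; exact: Av.
Qed.

Lemma tuple_measure_unique (R : realType) (m1 m2 : {measure set (N.-tuple X) -> \bar R}) :
  (m1 setT < +oo)%E ->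
  (forall A, (forall k, measurable (A k)) -> m1 (box A) = m2 (box A)) ->
  forall D, measurable D -> m1 D = m2 D.
Proof.
move=> m1oo m12; pose boxes := [set box A | A in [set A | forall k, measurable (A k)]].
apply: (measure_unique boxes (fun=> setT)) => //.
- apply/seteqP; split; last first.
    apply: smallest_sub; first exact: sigma_algebra_measurable.
    by move=> _ [A mA <-]; exact: measurable_box.
  apply: smallest_sub; first exact: smallest_sigma_algebra.
  rewrite -bigcup_seq => _ [k _ [B mB <-]]; apply: sub_sigma_algebra.
  exists (fun j => if j == k then B else setT); first by move=> j; case: ifP.
  rewrite setTI; apply/seteqP; split=> [v /(_ k)|v vB j]; first by rewrite eqxx.
  by case: eqP => // ->.
- move=> _ _ [A mA <-] [B mB <-]; exists (fun k => A k `&` B k).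
    by move=> k; exact: measurableI.
  by apply/seteqP; split=> [v vAB|v [vA vB] k]; [split=> k; have [] := vAB k|].
- by move=> _; exists (fun=> setT) => //; apply/seteqP; split.
- by rewrite bigcup_const//; exists 0%N.
- by move=> _ [A mA <-]; exact: m12.
Qed.

End tuples.

Section block_laws.
Context {R : realType} d (X : measurableType d) dZ (Z : measurableType dZ)
  (G0 : probability Z R) (N : nat) (mark : 'I_N -> {mfun Z >-> X}).
Implicit Types (A : 'I_N -> set X) (b : seq 'I_N) (r : seq (seq 'I_N)).

Definition partial_box b A : set (N.-tuple X) :=
  [set v | forall k, k \in b -> A k (tnth v k)].

Definition mark_event A : 'I_N -> set Z := fun k => mark k @^-1` A k.

Definition overwrite b (y : Z * N.-tuple X) : N.-tuple X :=
  [tuple if k \in b then mark k y.1 else tnth y.2 k | k < N].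

Lemma measurable_mark_event A k : measurable (A k) -> measurable (mark_event A k).
Proof. by move=> mA; rewrite -[X in measurable X]setTI; exact: measurable_funP. Qed.

Lemma measurable_partial_box b A : (forall k, measurable (A k)) ->
  measurable (partial_box b A).
Proof.
move=> mA; rewrite (_ : partial_box b A = box (fun k => if k \in b then A k else setT)).
  by apply: measurable_box => k; case: ifP.
apply/seteqP; split=> v vA k; first by case: ifP => // /vA.
by move=> kb; have := vA k; rewrite kb.
Qed.

Lemma measurable_overwrite b : measurable_fun setT (overwrite b).
Proof.
apply/measurable_fun_tnthP => k.
rewrite (_ : _ \o _ = fun y => if k \in b then mark k y.1 else tnth y.2 k); last first.
  by apply/funext => y; rewrite /= tnth_mktuple.
case: (k \in b); first exact: (measurableT_comp (measurable_funP (mark k)) measurable_fst).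
exact: (measurableT_comp (measurable_tnth k) measurable_snd).
Qed.

HB.instance Definition _ b := isMeasurableFun.Build _ _ _ _ (overwrite b)
  (measurable_overwrite b).

(* The blocks have independent locations of law [G0], each item of a block
   carrying a mark of its location. *)
Fixpoint block_law r : probability (N.-tuple X) R :=
  if r is b :: r' then distribution (G0 \x block_law r')%E (overwrite b)
  else dirac [tuple point | k < N].

Lemma preimage_overwrite b s A : uniq (b ++ s) ->
  overwrite b @^-1` partial_box (b ++ s) A =
  block_event (mark_event A) b `*` partial_box s A.
Proof.
rewrite cat_uniq => /and3P[_ /hasPn bs _].
apply/seteqP; split=> [[z v] /= zvA|[z v] [/= zA vA] k].
  split=> [k /= kb|k ks]; have := zvA k; rewrite mem_cat tnth_mktuple.
    by rewrite kb; exact.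
  by rewrite ks orbT (negbTE (bs _ ks)); exact.
rewrite mem_cat tnth_mktuple; case: ifPn => [kb _|_ /= ks]; first exact: zA.
exact: vA.
Qed.

Lemma ge0_integral_block_law b r A (g : N.-tuple X -> \bar R) (h : Z -> \bar R) :
  uniq (flatten (b :: r)) -> (forall k, measurable (A k)) ->
  measurable_fun setT g -> (forall v, 0 <= g v)%E ->
  measurable_fun setT h -> (forall z, 0 <= h z)%E ->
  (forall z v, g (overwrite b (z, v)) = h z) ->
  (\int[block_law (b :: r)]_(v in partial_box (flatten (b :: r)) A) g v =
   (\int[G0]_(z in block_event (mark_event A) b) h z) *
     block_law r (partial_box (flatten r) A))%E.
Proof.
move=> ur mA mg g_ge0 mh h_ge0 gh.
have mB : measurable (partial_box (flatten r) A) by exact: measurable_partial_box.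
rewrite (ge0_integral_pushforward (measurable_overwrite b)); last 3 first.
- exact: measurable_partial_box.
- exact: measurable_funTS.
- by move=> v _.
have mE : measurable (block_event (mark_event A) b).
  by apply: measurable_block_event => k; exact: measurable_mark_event (mA k).
rewrite preimage_overwrite// [X in (X * _)%E]integral_mkcond.
rewrite -(setIT (partial_box (flatten r) A)) -integral_indic// setIT.
rewrite -ge0_integral_prodM//.
- rewrite integral_mkcond; apply: eq_integral => -[z v] _.
  rewrite !patchE/= gh indicE in_setX/=.
  by case: (z \in _); case: (v \in _); rewrite ?mule1 ?mule0.
- by apply/(measurable_restrictT _ mE); exact: measurable_funTS.
- exact/measurable_EFinP/measurable_indic.
- by move=> z; exact: erestrict_ge0.
Qed.

Lemma block_law_box r A : uniq (flatten r) -> (forall k, measurable (A k)) ->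
  block_law r (partial_box (flatten r) A) =
  (\prod_(b <- r) fine (G0 (block_event (mark_event A) b)))%:E.
Proof.
move=> + mA; elim: r => [_|b r ih ur].
  by rewrite big_nil /= diracE mem_set.
have := @ge0_integral_block_law b r A (cst 1%E) (cst 1%E) ur mA
  (measurable_cst _) (fun=> lee01) (measurable_cst _) (fun=> lee01) (fun _ _ => erefl).
have mB : measurable (partial_box (flatten (b :: r)) A) by exact: measurable_partial_box.
have mE : measurable (block_event (mark_event A) b).
  by apply: measurable_block_event => k; exact: measurable_mark_event (mA k).
rewrite !integral_cst// !mul1e => ->.
rewrite big_cons EFinM fineK ?fin_num_measure// ih//.
by move: ur; rewrite /= cat_uniq => /and3P[].
Qed.

End block_laws.

(** * Conditional kernels *)

Section integral_rectangle.
Context {R : realType} d1 d2 (T1 : measurableType d1) (T2 : measurableType d2)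
  (m1 : {sigma_finite_measure set T1 -> \bar R})
  (m2 : {sigma_finite_measure set T2 -> \bar R}).
Variables (A : set T1) (B : set T2) (f : T1 * T2 -> \bar R).
Hypotheses (mA : measurable A) (mB : measurable B).
Hypotheses (mf : measurable_fun setT f) (f_ge0 : forall z, (0 <= f z)%E).

Let restrictX x y :
  (f \_ (A `*` B)) (x, y) = if x \in A then if y \in B then f (x, y) else 0%E else 0%E.
Proof. by rewrite patchE in_setX/=; case: (x \in A). Qed.

Let mf_restrict : measurable_fun setT (f \_ (A `*` B)).
Proof. by apply/(measurable_restrictT _ (measurableX mA mB)); exact: measurable_funTS. Qed.

Let f_restrict_ge0 z : (0 <= (f \_ (A `*` B)) z)%E.
Proof. exact: erestrict_ge0. Qed.

Lemma ge0_integral_setX1 :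
  (\int[m1 \x m2]_(z in A `*` B) f z = \int[m1]_(x in A) \int[m2]_(y in B) f (x, y))%E.
Proof.
rewrite integral_mkcond fubini_tonelli1// [RHS]integral_mkcond.
apply: eq_integral => x _; rewrite /fubini_F; under eq_integral do rewrite restrictX.
rewrite patchE; case: ifP => _; last exact: integral0.
by rewrite [RHS]integral_mkcond.
Qed.

Lemma ge0_integral_setX2 :
  (\int[m1 \x m2]_(z in A `*` B) f z = \int[m2]_(y in B) \int[m1]_(x in A) f (x, y))%E.
Proof.
rewrite integral_mkcond fubini_tonelli2// [RHS]integral_mkcond.
apply: eq_integral => y _; rewrite /fubini_G; under eq_integral do rewrite restrictX.
rewrite patchE; case: ifP => yB.
  by rewrite [RHS]integral_mkcond.
by rewrite integral0_eq// => x _; rewrite if_same.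
Qed.

End integral_rectangle.

Section pair_coord.
Context d (X : measurableType d).
Implicit Types (e : bool) (A : set X).

Definition pair_coord e (z : X * X) : X := if e then z.1 else z.2.

Lemma measurable_pair_coord e : measurable_fun setT (pair_coord e).
Proof. by case: e; [exact: measurable_fst|exact: measurable_snd]. Qed.

HB.instance Definition _ e := isMeasurableFun.Build _ _ _ _ (pair_coord e)
  (measurable_pair_coord e).

Definition cylinder e A : set (X * X) := pair_coord e @^-1` A.

Lemma measurable_cylinder e A : measurable A -> measurable (cylinder e A).
Proof. by move=> mA; exact: measurable_preimageT (measurable_pair_coord e) mA. Qed.

Lemma cylinder_trueE A : cylinder true A = A `*` setT.
Proof. by rewrite setXT. Qed.

Lemma cylinder_falseE A : cylinder false A = setT `*` A.
Proof. by rewrite setTX. Qed.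

End pair_coord.

Section conditional_kernels.
Context {R : realType} d (X : measurableType d)
  (G0 : probability (X * X)%type R) (P0 : probability X R).
Hypothesis marginal : forall A : set X, measurable A ->
  G0 (A `*` setT) = P0 A /\ G0 (setT `*` A) = P0 A.
Variables (lam : {sigma_finite_measure set X -> \bar R}) (g0 : X * X -> R) (p0 : X -> R).
Hypotheses (mg0 : measurable_fun setT g0) (g0_ge0 : forall z, 0 <= g0 z).
Hypothesis G0_density : forall A : set (X * X), measurable A ->
  G0 A = (\int[(lam \x lam)%E]_(z in A) (g0 z)%:E)%E.
Hypotheses (mp0 : measurable_fun setT p0) (p0_ge0 : forall x, 0 <= p0 x).
Hypothesis P0_density : forall A : set X, measurable A ->
  P0 A = (\int[lam]_(x in A) (p0 x)%:E)%E.
Implicit Types (e : bool) (A B C : set X).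

Lemma marginal_cylinder e A : measurable A -> G0 (cylinder e A) = P0 A.
Proof.
by move=> /marginal[G01 G02]; case: e; rewrite ?cylinder_trueE ?cylinder_falseE.
Qed.

Lemma integral_marginal e B (f : X -> \bar R) : measurable B -> measurable_fun setT f ->
  (forall y, (0 <= f y)%E) ->
  (\int[G0]_(z in cylinder e B) f (pair_coord e z) = \int[P0]_(y in B) f y)%E.
Proof.
move=> mB mf f_ge0.
rewrite -(ge0_integral_pushforward (measurable_pair_coord e))//; last exact: measurable_funTS.
by apply: eq_measure_integral => A mA _; exact: marginal_cylinder.
Qed.

Definition cond_kernel e_next (y : X) C : \bar R :=
  if e_next then Rker lam g0 p0 y C else Qker lam g0 p0 y C.

Definition slice_mass e_next C (y : X) : \bar R :=
  (\int[lam]_(c in C) (g0 (if e_next then (c, y) else (y, c)))%:E)%E.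

Lemma cond_kernelE e_next y C : cond_kernel e_next y C = (slice_mass e_next C y * ((p0 y)^-1)%:E)%E.
Proof. by case: e_next. Qed.

Lemma slice_mass_ge0 e_next C y : (0 <= slice_mass e_next C y)%E.
Proof. by apply: integral_ge0 => c _; rewrite lee_fin. Qed.

Lemma measurable_slice_mass e_next C : measurable C -> measurable_fun setT (slice_mass e_next C).
Proof.
move=> mC; pose f := ((EFin \o g0) \_ (cylinder e_next C))%E.
have mf : measurable_fun setT f.
  apply/(measurable_restrictT _ (measurable_cylinder e_next mC)).
  exact/measurable_funTS/measurable_EFinP.
have f_ge0 z : (0 <= f z)%E by apply: erestrict_ge0 => z' _; rewrite lee_fin.
rewrite (_ : slice_mass e_next C = if e_next then fubini_G lam f else fubini_F lam f).
  by case: e_next @f mf f_ge0 => f mf f_ge0;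
    [exact: measurable_fun_fubini_tonelli_G|exact: measurable_fun_fubini_tonelli_F].
apply/funext => y; rewrite /slice_mass integral_mkcond.
by case: e_next @f mf f_ge0 => f _ _; apply: eq_integral => c _; rewrite !patchE.
Qed.

Lemma integral_slice_mass e_next B C : measurable B -> measurable C ->
  (\int[lam]_(y in B) slice_mass e_next C y = G0 (cylinder e_next C `&` cylinder (~~ e_next) B))%E.
Proof.
move=> mB mC; have mEg0 : measurable_fun setT (EFin \o g0) by exact/measurable_EFinP.
have Eg0_ge0 z : (0 <= (EFin \o g0) z)%E by rewrite lee_fin.
rewrite G0_density; last by apply: measurableI; exact: measurable_cylinder.
case: e_next; rewrite /= cylinder_trueE cylinder_falseE -setXI setTI setIT.
  by rewrite (ge0_integral_setX2 lam lam mC mB mEg0 Eg0_ge0).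
by rewrite (ge0_integral_setX1 lam lam mB mC mEg0 Eg0_ge0).
Qed.

Let p0_integrable : lam.-integrable setT (EFin \o p0).
Proof.
by apply/ge0_integrable_EFinP => //; rewrite -P0_density// probability_setT ltry.
Qed.

Lemma ae_slice_mass_setT e_next : ae_eq lam setT (EFin \o p0) (slice_mass e_next setT).
Proof.
apply: integral_ae_eq => //; first exact: measurable_slice_mass.
move=> B _ mB; rewrite integral_slice_mass// [cylinder e_next setT]preimage_setT setTI.
by rewrite marginal_cylinder// P0_density.
Qed.

Lemma integral_P0 B (f : X -> \bar R) : measurable B -> measurable_fun setT f ->
  (forall y, (0 <= f y)%E) ->
  (\int[P0]_(y in B) f y = \int[lam]_(y in B) ((p0 y)%:E * f y))%E.
Proof.
move=> mB mf f_ge0; rewrite integral_mkcond.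
rewrite -(ge0_integral_weighted_pushforward (P := lam) (m := P0) (W := p0)
  (V := id))//.
- rewrite [RHS]integral_mkcond; apply: eq_integral => y _.
  by rewrite !patchE; case: ifP; rewrite ?mule0.
- by move=> A mA; exact/esym/P0_density.
- by apply/(measurable_restrictT _ mB); exact: measurable_funTS.
- exact: erestrict_ge0.
Qed.

Lemma cond_kernel_ge0 e_next y C : (0 <= cond_kernel e_next y C)%E.
Proof. by rewrite cond_kernelE mule_ge0 ?slice_mass_ge0// lee_fin invr_ge0. Qed.

Lemma measurable_cond_kernel e_next C : measurable C ->
  measurable_fun setT (fun y => cond_kernel e_next y C).
Proof.
move=> mC; under eq_fun do rewrite cond_kernelE.
apply: emeasurable_funM; first exact: measurable_slice_mass.
by apply/measurable_EFinP; exact: measurable_invr_ge0.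
Qed.

Lemma integral_cond_kernel e_next B C : measurable B -> measurable C ->
  (\int[P0]_(y in B) cond_kernel e_next y C = G0 (cylinder e_next C `&` cylinder (~~ e_next) B))%E.
Proof.
move=> mB mC; have mK := measurable_cond_kernel e_next mC.
rewrite integral_P0//; last by move=> y; exact: cond_kernel_ge0.
rewrite -integral_slice_mass//; apply: ae_eq_integral => //.
- by apply: emeasurable_funM; apply/measurable_funTS => //; exact/measurable_EFinP.
- exact/measurable_funTS/measurable_slice_mass.
apply: filterS (ae_slice_mass_setT e_next) => y /(_ Logic.I)/= p0E _.
rewrite cond_kernelE muleCA -EFinM; have [p00|p0_neq0] := eqVneq (p0 y) 0; last first.
  by rewrite divff// mule1.
rewrite p00 mul0r mule0; apply/eqP; rewrite eq_le slice_mass_ge0/=.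
apply: (@le_trans _ _ (slice_mass e_next setT y)); last by rewrite -p0E p00.
apply: ge0_subset_integral => //.
  apply/measurable_EFinP.
  by case: e_next {p0E mK}; [exact: (measurableT_comp mg0 (pair2_measurable y))|
    exact: (measurableT_comp mg0 (pair1_measurable y))].
by move=> c _; rewrite lee_fin.
Qed.

(* The law of coordinate [e_next] of a location given that its coordinate [e] is [y]. *)
Definition seen_kernel e e_next (y : X) C : \bar R :=
  if e == e_next then \d_y C else cond_kernel e_next y C.

Lemma seen_kernel_ge0 e e_next y C : (0 <= seen_kernel e e_next y C)%E.
Proof. by rewrite /seen_kernel; case: ifP => // _; exact: cond_kernel_ge0. Qed.

Lemma measurable_seen_kernel e e_next C : measurable C ->
  measurable_fun setT (fun y => seen_kernel e e_next y C).
Proof.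
move=> mC; rewrite /seen_kernel; case: (e == e_next); last exact: measurable_cond_kernel.
exact/measurable_EFinP/measurable_indic.
Qed.

Variables (N : nat) (e : 'I_N -> bool) (e_next : bool).
Implicit Types (b : seq 'I_N) (r : seq (seq 'I_N)) (F : 'I_N -> set X).

(* The items are the [N] observations and, as [None], the next one; item [o]
   records coordinate [item_coord o] of its location. *)
Definition item_coord (o : option 'I_N) : bool := oapp e e_next o.

Definition item_event F C (o : option 'I_N) : set (X * X) :=
  cylinder (item_coord o) (oapp F C o).

Definition item_mark k : {mfun (X * X)%type >-> X} := pair_coord (e k).

Definition component_mass (c : seq (seq (option 'I_N))) F C : R :=
  \prod_(b <- c) fine (G0 (block_event (item_event F C) b)).

Definition next_kernel (o : option 'I_N) (v : N.-tuple X) C : \bar R :=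
  if o is Some k then seen_kernel (e k) e_next (tnth v k) C else P0 C.

Lemma measurable_item_event F C o : (forall k, measurable (F k)) -> measurable C ->
  measurable (item_event F C o).
Proof. by move=> mF mC; apply: measurable_cylinder; case: o. Qed.

Lemma next_kernel_ge0 o v C : (0 <= next_kernel o v C)%E.
Proof. by case: o => [k|] //=; exact: seen_kernel_ge0. Qed.

Lemma measurable_next_kernel o C : measurable C ->
  measurable_fun setT (fun v => next_kernel o v C).
Proof.
move=> mC; case: o => [k|] //=.
exact: (measurableT_comp (measurable_seen_kernel (e k) e_next mC) (measurable_tnth k)).
Qed.

Let measurable_mark_block F b : (forall k, measurable (F k)) ->
  measurable (block_event (mark_event item_mark F) b).
Proof.
by move=> mF; apply: measurable_block_event => k; exact: measurable_mark_event (mF k).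
Qed.

Lemma block_event_map_Some F C b :
  block_event (item_event F C) (map Some b) = block_event (mark_event item_mark F) b.
Proof.
apply/seteqP; split=> [z zF k kb|z zF _ /mapP[k kb ->]]; last exact: zF.
by apply: (zF (Some k)); exact: map_f.
Qed.

Lemma block_event_next F C b : block_event (item_event F C) (None :: map Some b) =
  block_event (mark_event item_mark F) b `&` cylinder e_next C.
Proof.
rewrite -(block_event_map_Some F C); apply/seteqP; split=> [z zF|z [zF zC] o].
  split; last exact: (zF None (mem_head _ _)).
  by move=> o ob; apply: zF; rewrite /= inE ob orbT.
by rewrite /= inE => /orP[/eqP ->//|]; exact: zF.
Qed.

Lemma component_mass_next F C b r :
  component_mass ((None :: map Some b) :: map (map Some) r) F C =
  fine (G0 (block_event (mark_event item_mark F) b `&` cylinder e_next C)) *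
  \prod_(b' <- r) fine (G0 (block_event (mark_event item_mark F) b')).
Proof.
rewrite /component_mass big_cons block_event_next big_map; congr (_ * _).
by apply: eq_bigr => b' _; rewrite block_event_map_Some.
Qed.

Lemma block_kernel b : b != [::] -> exists2 k, k \in b &
  forall F C, (forall j, measurable (F j)) -> measurable C ->
  (\int[G0]_(z in block_event (mark_event item_mark F) b)
     seen_kernel (e k) e_next (pair_coord (e k) z) C =
   G0 (block_event (mark_event item_mark F) b `&` cylinder e_next C))%E.
Proof.
have [/hasP[k kb /eqP ek] _|/hasPn opp] := boolP (has (fun k => e k == e_next) b).
  exists k => // F C mF mC; rewrite /seen_kernel ek eqxx setIC.
  rewrite -integral_indic//; last exact: measurable_cylinder.
  exact: measurable_mark_block.
case: b opp => // k0 b opp _; exists k0; first exact: mem_head.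
have e_opp k : k \in k0 :: b -> e k = ~~ e_next by move=> /opp; case: (e k); case: e_next.
move=> F C mF mC; pose B := \bigcap_(k in [set k | k \in k0 :: b]) F k.
have mB : measurable B by exact: fin_bigcap_measurable.
have -> : block_event (mark_event item_mark F) (k0 :: b) = cylinder (~~ e_next) B.
  by apply/seteqP; split=> z zF k kb; have := zF k kb; rewrite /mark_event/cylinder/= e_opp.
have -> : seen_kernel (e k0) e_next = cond_kernel e_next.
  by rewrite /seen_kernel e_opp ?mem_head//; case: e_next.
rewrite e_opp ?mem_head// (@integral_marginal (~~ e_next) B (cond_kernel e_next ^~ C))//.
- by rewrite integral_cond_kernel// setIC.
- exact: measurable_cond_kernel.
- by move=> y; exact: cond_kernel_ge0.
Qed.

Lemma partial_box_perm_enum (s : seq 'I_N) F : perm_eq s (enum 'I_N) ->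
  partial_box s F = box F.
Proof.
move=> /perm_mem sE; apply/seteqP; split=> v vF k; last by move=> _; exact: vF.
by apply: vF; rewrite sE mem_enum.
Qed.

Definition component_law c (kappa : probability (N.-tuple X) R) (o : option 'I_N) :=
  forall F, (forall k, measurable (F k)) ->
  (component_mass c F setT)%:E = kappa (box F) /\
  forall C, measurable C ->
    (component_mass c F C)%:E = (\int[kappa]_(v in box F) next_kernel o v C)%E.

Lemma component_law_new r : perm_eq (flatten r) (enum 'I_N) ->
  component_law ([:: None] :: map (map Some) r) (block_law G0 item_mark r) None.
Proof.
move=> perm_r F mF.
have uniq_r : uniq (flatten r) by rewrite (perm_uniq perm_r) enum_uniq.
have boxE := block_law_box G0 item_mark uniq_r mF.
rewrite partial_box_perm_enum// in boxE.
have massE C : measurable C -> (component_mass ([:: None] :: map (map Some) r) F C)%:E =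
    (P0 C * block_law G0 item_mark r (box F))%E.
  move=> mC; rewrite (component_mass_next F C [::] r) boxE EFinM.
  rewrite (_ : block_event _ [::] = setT); last by apply/seteqP; split.
  by rewrite setTI marginal_cylinder// fineK// fin_num_measure.
split=> [|C mC]; first by rewrite massE// probability_setT mul1e.
by rewrite massE// integral_cst//; exact: measurable_box.
Qed.

Lemma component_law_joined b r : b != [::] -> perm_eq (flatten (b :: r)) (enum 'I_N) ->
  exists k, component_law ((None :: map Some b) :: map (map Some) r)
    (block_law G0 item_mark (b :: r)) (Some k).
Proof.
move=> b_neq0 perm_br; have [k kb kernelE] := block_kernel b_neq0; exists k => F mF.
have uniq_br : uniq (flatten (b :: r)) by rewrite (perm_uniq perm_br) enum_uniq.
have uniq_r : uniq (flatten r) by move: uniq_br; rewrite cat_uniq => /and3P[].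
rewrite -(partial_box_perm_enum F perm_br).
split=> [|C mC]; rewrite component_mass_next.
  rewrite block_law_box// big_cons (_ : cylinder e_next setT = setT) ?setIT//.
rewrite (@ge0_integral_block_law _ _ _ _ _ G0 _ item_mark b r F (next_kernel (Some k) ^~ C)
  (fun z => seen_kernel (e k) e_next (pair_coord (e k) z) C))//.
- rewrite kernelE// block_law_box// EFinM fineK// fin_num_measure//.
  by apply: measurableI; [exact: measurable_mark_block|exact: measurable_cylinder].
- exact: measurable_next_kernel (Some k) _ mC.
- by move=> v; exact: next_kernel_ge0.
- exact: (measurableT_comp (measurable_seen_kernel (e k) e_next mC) (measurable_pair_coord _)).
- by move=> z; exact: seen_kernel_ge0.
- by move=> z v; rewrite /next_kernel tnth_mktuple kb.
Qed.

Lemma exists_component_law c : c \in seq_partitions (None :: map Some (enum 'I_N)) ->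
  exists kappa o, component_law c kappa o.
Proof.
case/seq_partitions_optionP=> r rN.
have perm_r := perm_flatten_seq_partitions rN.
case=> [->|[b br cE]]; first by do 2!eexists; exact: component_law_new.
have perm_br : perm_eq (flatten (b :: rem b r)) (enum 'I_N).
  by apply: perm_trans perm_r; rewrite perm_sym; exact: perm_flatten (perm_to_rem br).
have [k lawE] := component_law_joined (seq_partitions_neq0 rN br) perm_br.
exists (block_law G0 item_mark (b :: rem b r)), (Some k) => F mF.
have massE C : component_mass c F C =
    component_mass ((None :: map Some b) :: map (map Some) (rem b r)) F C by exact: perm_big.
rewrite massE; have [-> kernelE] := lawE F mF.
by split=> // C mC; rewrite massE kernelE.
Qed.

End conditional_kernels.

(** * Posterior weights *)

Section mixture_densities.
Context {R : realType} d (T : measurableType d) (I : finType).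
Variables (wt : I -> R) (kappa : I -> probability T R) (M : probability T R).
Hypothesis wt_ge0 : forall i, 0 <= wt i.
Hypothesis mixtureE : forall D, measurable D ->
  M D = (\sum_i (wt i)%:E * kappa i D)%E.

Let part i := mscale (NngNum (wt_ge0 i)) (kappa i).

Let part_dominated i : part i `<< M.
Proof.
apply/null_content_dominatesP => D mD MD0.
have /eqP := etrans (esym (mixtureE mD)) MD0.
rewrite seq_psume_eq0; last by move=> j _; rewrite mule_ge0// lee_fin.
by move=> /allP/(_ i (mem_index_enum _)) /eqP.
Qed.

Definition mixture_density i : T -> R := fine \o Radon_Nikodym_SigmaFinite.f (part i) M.

Lemma mixture_density_ge0 i v : 0 <= mixture_density i v.
Proof. exact/fine_ge0/(Radon_Nikodym_SigmaFinite.f_ge0 (part_dominated i)). Qed.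

Lemma measurable_mixture_density i : measurable_fun setT (mixture_density i).
Proof.
apply: (@measurableT_comp _ _ _ _ _ _ fine) => //.
exact: measurable_int (Radon_Nikodym_SigmaFinite.f_integrable (part_dominated i)).
Qed.

Lemma integral_mixture_density i D (f : T -> \bar R) :
  measurable D -> measurable_fun setT f -> (forall v, 0 <= f v)%E ->
  (\int[M]_(v in D) ((mixture_density i v)%:E * f v) =
   (wt i)%:E * \int[kappa i]_(v in D) f v)%E.
Proof.
move=> mD mf f_ge0; have mfD : measurable_fun D f by exact: measurable_funTS.
rewrite -(ge0_integral_mscale _ mD (NngNum (wt_ge0 i)))//.
rewrite -(Radon_Nikodym_SigmaFinite.change_of_variables (part_dominated i) f_ge0 mD mfD).
apply: eq_integral => v _; rewrite muleC fineK//.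
exact: Radon_Nikodym_SigmaFinite.f_fin_num (part_dominated i) v.
Qed.

Lemma ae_sum_mixture_density : {ae M, forall v, \sum_i mixture_density i v = 1}.
Proof.
have mh i : measurable_fun setT (EFin \o mixture_density i).
  exact/measurable_EFinP/measurable_mixture_density.
suff : ae_eq M setT (cst 1%E) (fun v => \sum_i (mixture_density i v)%:E)%E.
  by apply: filterS => v /(_ Logic.I)/=; rewrite sumEFin => -[<-].
apply: integral_ae_eq => //.
- exact: finite_measure_integrable_cst.
- exact: emeasurable_sum.
move=> D _ mD; rewrite ge0_integral_sum//; first last.
- by move=> i v _; rewrite lee_fin mixture_density_ge0.
- by move=> i; exact/measurable_funTS/mh.
rewrite integral_cst// mul1e [LHS](mixtureE mD); apply: eq_bigr => i _.
transitivity (\int[M]_(v in D) ((mixture_density i v)%:E * cst 1%E v))%E; last first.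
  by apply: eq_integral => v _; rewrite mule1.
by rewrite integral_mixture_density// integral_cst// mul1e.
Qed.

Lemma mixture_posterior (i0 : I) : exists h : I -> T -> R,
  [/\ forall i, measurable_fun setT (h i),
      forall i v, 0 <= h i v,
      forall v, \sum_i h i v = 1 &
      forall i D f, measurable D -> measurable_fun setT f -> (forall v, 0 <= f v)%E ->
        (\int[M]_(v in D) ((h i v)%:E * f v) = (wt i)%:E * \int[kappa i]_(v in D) f v)%E].
Proof.
pose total v := \sum_i mixture_density i v.
have mtotal : measurable_fun setT (fun v => total v == 1).
  apply: (measurable_fun_eqr (f := total) (g := cst 1)) => //.
  by apply: measurable_sum => i; exact: measurable_mixture_density.
pose h i v := if total v == 1 then mixture_density i v else (i == i0)%:R.
have mh i : measurable_fun setT (h i).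
  by apply: measurable_fun_ifT => //; exact: measurable_mixture_density.
exists h; split=> //.
- by move=> i v; rewrite /h; case: ifP => // _; exact: mixture_density_ge0.
- move=> v; rewrite /h; case: eqP => // _.
  by rewrite (bigD1 i0)//= eqxx big1 ?addr0// => i /negbTE ->.
move=> i D f mD mf f_ge0; rewrite -integral_mixture_density//.
apply: ae_eq_integral => //.
- by apply: measurable_funTS; apply: emeasurable_funM => //; exact/measurable_EFinP.
- apply: measurable_funTS; apply: emeasurable_funM => //.
  exact/measurable_EFinP/measurable_mixture_density.
by apply: filterS ae_sum_mixture_density => v totalE _; rewrite /h /total totalE eqxx.
Qed.

End mixture_densities.

Section predictive_weights.
Context {R : realType} d (X : measurableType d) (N : nat) (I : finType) (i0 : I).
Local Notation data := (N.-tuple X).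

Lemma tuple_measure_sumE (m : {measure set data -> \bar R})
    (part : I -> {measure set data -> \bar R}) : (m setT < +oo)%E ->
  (forall F, (forall k, measurable (F k)) -> m (box F) = (\sum_i part i (box F))%E) ->
  forall D, measurable D -> m D = (\sum_i part i D)%E.
Proof.
move=> moo m_box D mD; pose part_nat k := part (nth i0 (index_enum I) k).
have sumE B : msum part_nat (size (index_enum I)) B = (\sum_i part i B)%E.
  by rewrite /msum [RHS](big_nth i0) big_mkord.
rewrite -sumE; apply: tuple_measure_unique mD => // F mF.
by rewrite [RHS]sumE; exact: m_box.
Qed.

Context dO (Omega : measurableType dO) (P : probability Omega R)
  dY (Y : measurableType dY) (J : finType).
Variables (obs : {mfun Omega >-> data}) (next : {mfun Omega >-> Y}).
Variables (wt : I -> R) (kappa : I -> probability data R) (kind : I -> J)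
  (K : J -> data -> set Y -> \bar R).
Hypothesis wt_ge0 : forall i, 0 <= wt i.
Hypothesis K_ge0 : forall j v C, (0 <= K j v C)%E.
Hypothesis mK : forall j C, measurable C -> measurable_fun setT (K j ^~ C).
Hypothesis law_obs : forall F, (forall k, measurable (F k)) ->
  P (obs @^-1` box F) = (\sum_i (wt i)%:E * kappa i (box F))%E.
Hypothesis law_next : forall F C, (forall k, measurable (F k)) -> measurable C ->
  P (obs @^-1` box F `&` next @^-1` C) =
  (\sum_i (wt i)%:E * \int[kappa i]_(v in box F) K (kind i) v C)%E.

Let M : probability data R := distribution P obs.

Lemma law_obs_mixture D : measurable D -> M D = (\sum_i (wt i)%:E * kappa i D)%E.
Proof.
move=> mD; pose part i := mscale (NngNum (wt_ge0 i)) (kappa i).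
rewrite (@tuple_measure_sumE M part)//.
exact: le_lt_trans (probability_le1 M measurableT) (ltry _).
Qed.

Lemma law_next_mixture D C : measurable D -> measurable C ->
  P (obs @^-1` D `&` next @^-1` C) =
  (\sum_i (wt i)%:E * \int[kappa i]_(v in D) K (kind i) v C)%E.
Proof.
move=> mD mC; have mnC := measurable_funPTI next mC.
pose part i := mscale (NngNum (wt_ge0 i))
  (density_measure (kappa i) (mK (kind i) mC) (fun v => K_ge0 (kind i) v C)).
rewrite -[LHS]/(pushforward (mrestr P mnC) obs D) (@tuple_measure_sumE _ part)//.
  apply: (@le_lt_trans _ _ 1%E); last exact: ltry.
  apply: (@probability_le1 _ _ _ P (obs @^-1` setT `&` next @^-1` C)).
  by apply: measurableI => //; exact: measurable_funPTI.
by move=> F mF; rewrite -[RHS](law_next mF mC).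
Qed.

Lemma predictive_weights : exists g : J -> data -> R,
  [/\ forall j, measurable_fun setT (g j),
      forall j v, 0 <= g j v,
      forall v, \sum_j g j v = 1 &
      forall D C, measurable D -> measurable C ->
        (P (obs @^-1` D `&` next @^-1` C) =
         \int[P]_(w in obs @^-1` D) \sum_j (g j (obs w))%:E * K j (obs w) C)%E].
Proof.
have [h [mh h_ge0 sum_h integral_h]] := mixture_posterior wt_ge0 law_obs_mixture i0.
pose g j v := \sum_(i | kind i == j) h i v.
have mg j : measurable_fun setT (g j).
  rewrite /g; under eq_fun do rewrite big_mkcond.
  by apply: measurable_sum => i; case: (kind i == j).
have g_ge0 j v : 0 <= g j v by exact: sumr_ge0.
exists g; split=> // [v|D C mD mC].
  by rewrite -(sum_h v) [RHS](partition_big kind xpredT).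
have mKC j : measurable_fun setT (K j ^~ C) := mK j mC.
have mpart i : measurable_fun setT (fun v => (h i v)%:E * K (kind i) v C)%E.
  by apply: emeasurable_funM => //; exact/measurable_EFinP.
have part_ge0 i v : (0 <= (h i v)%:E * K (kind i) v C)%E by rewrite mule_ge0// lee_fin.
have pooledE v : (\sum_j (g j v)%:E * K j v C = \sum_i (h i v)%:E * K (kind i) v C)%E.
  rewrite [RHS](partition_big kind xpredT)//=; apply: eq_bigr => j _.
  rewrite -sumEFin ge0_sume_distrl; last by move=> i _; rewrite lee_fin.
  by apply: eq_bigr => i /eqP ->.
under eq_integral do rewrite pooledE.
rewrite law_next_mixture// -(ge0_integral_pushforward (@measurable_funP _ _ _ _ setT obs) P
  (f := fun v => \sum_i (h i v)%:E * K (kind i) v C)%E)//.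
- rewrite ge0_integral_sum//; last by move=> i; exact: measurable_funTS.
  by apply: eq_bigr => i _; rewrite integral_h.
- by apply: measurable_funTS; exact: emeasurable_sum.
- by move=> v _; exact: sume_ge0.
Qed.

End predictive_weights.

(** * Distinct values and the sigma-algebra of the data *)

Lemma measurable_diagonal (R : realType) d (X : measurableType d) :
  polish_space R X -> measurable [set z : X * X | z.1 = z.2].
Proof.
move=> [dist [[dist0 distC] dist_tri _ [S S_dense] borelX]].
have mball x r : measurable (dist_ball dist x r).
  rewrite borelX; apply: sub_sigma_algebra => y xy.
  exists (r - dist x y); first by rewrite subr_gt0.
  by move=> z yz; apply: le_lt_trans (dist_tri x y z) _; rewrite -ltrBrDl.
have dist_gt0 x y : x <> y -> 0 < dist x y.
  have := dist_tri x y x; rewrite (distC y x) ((dist0 x x).2 erefl) => xyx xy.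
  by rewrite lt_neqAle eq_sym; apply/andP; split; [by apply/eqP => /dist0|lra].
rewrite -[X in measurable X]setCK; apply: measurableC.
rewrite (_ : ~` _ = \bigcup_k \bigcup_p
   (dist_ball dist (S k) p.+1%:R^-1 `*` ~` dist_ball dist (S k) p.+1%:R^-1)).
  apply: bigcupT_measurable => k; apply: bigcupT_measurable => p.
  by apply: measurableX => //; exact: measurableC.
apply/seteqP; split=> [[x y] /= /dist_gt0 xy|[x y] [k _ [p _ [/= Sx nSy xy]]]]; last first.
  by apply: nSy; rewrite -xy.
have [p pxy] : exists p : nat, p.+1%:R^-1 < dist x y / 2.
  exists (Num.truncn (dist x y / 2)^-1).
  by rewrite invf_plt ?posrE ?ltr0n ?divr_gt0//; exact: truncnS_gt.
have [k xSk] : exists k, dist x (S k) < p.+1%:R^-1 by apply: S_dense; rewrite invr_gt0.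
exists k => //; exists p => //; split; first by rewrite /dist_ball/= distC.
rewrite /dist_ball/= => Sky; have := dist_tri x (S k) y; apply/negP; rewrite -ltNge.
by rewrite [ltRHS]splitr ltrD// (lt_trans _ pxy).
Qed.

Section distinct_values.
Context d (X : measurableType d) dT (T : measurableType dT).
Hypothesis measurable_diag : measurable [set z : X * X | z.1 = z.2].

Lemma measurable_eqb (f g : T -> X) : measurable_fun setT f -> measurable_fun setT g ->
  measurable_fun setT (fun v => f v == g v).
Proof.
move=> mf mg; apply: (measurable_fun_bool true); rewrite setTI.
rewrite (_ : _ @^-1` _ = (fun v => (f v, g v)) @^-1` [set z | z.1 = z.2]).
  exact: measurable_preimageT (measurable_fun_pair mf mg) measurable_diag.
by apply/seteqP; split=> v /eqP.
Qed.

Lemma measurable_mem_map (I : Type) (s : seq I) (V : I -> T -> X) (f : T -> X) :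
  measurable_fun setT f -> (forall k, measurable_fun setT (V k)) ->
  measurable_fun setT (fun v => f v \in [seq V k v | k <- s]).
Proof.
move=> mf mV; elim: s => [|k s ih] /=; first exact: measurable_cst.
under eq_fun do rewrite inE.
by apply: measurable_or => //; exact: measurable_eqb.
Qed.

Lemma measurable_index_undup (I : Type) (s : seq I) (V : I -> T -> X) (f : T -> X) :
  measurable_fun setT f -> (forall k, measurable_fun setT (V k)) ->
  measurable_fun setT (fun v => index (f v) (undup [seq V k v | k <- s])).
Proof.
move=> mf mV; elim: s => [|k s ih] /=; first exact: measurable_cst.
rewrite (_ : (fun v => _) = fun v => if V k v \in [seq V j v | j <- s]
    then index (f v) (undup [seq V j v | j <- s])
    else if V k v == f v then 0%N
    else (index (f v) (undup [seq V j v | j <- s])).+1); last first.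
  by apply/funext => v; case: ifP.
apply: measurable_fun_ifT => //; first exact: measurable_mem_map.
apply: measurable_fun_ifT; [exact: measurable_eqb|exact: measurable_cst|].
exact: measurableT_comp.
Qed.

End distinct_values.

Section pooled_weights.
Context {R : realType} d (X : measurableType d) dT (T : measurableType dT) (I : finType).
Variables (V : I -> T -> X) (a : I -> T -> R).

Definition distinct v : seq X := undup [seq V k v | k <- enum I].

Definition pooled (i : nat) v : R := \sum_(k | index (V k v) (distinct v) == i) a k v.

Let mem_distinct k v : V k v \in distinct v.
Proof. by rewrite mem_undup map_f// mem_enum. Qed.

Let rank v k : 'I_(size (distinct v)) := Ordinal (etrans (index_mem _ _) (mem_distinct k v)).

Lemma sum_pooled v : \sum_(i < size (distinct v)) pooled i v = \sum_k a k v.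
Proof. by rewrite [RHS](partition_big (rank v) xpredT). Qed.

Hypothesis a_ge0 : forall k v, 0 <= a k v.

Lemma pooled_ge0 i v : 0 <= pooled i v.
Proof. exact: sumr_ge0. Qed.

Lemma esum_pooled v (h : X -> \bar R) :
  (\sum_(i < size (distinct v)) (pooled i v)%:E * h (nth point (distinct v) i) =
   \sum_k (a k v)%:E * h (V k v))%E.
Proof.
rewrite [RHS](partition_big (rank v) xpredT)//=; apply: eq_bigr => i _.
rewrite /pooled -sumEFin ge0_sume_distrl; last by move=> k _; rewrite lee_fin.
by apply: eq_bigr => k /eqP <-; rewrite nth_index.
Qed.

Hypothesis measurable_diag : measurable [set z : X * X | z.1 = z.2].
Hypotheses (mV : forall k, measurable_fun setT (V k)) (ma : forall k, measurable_fun setT (a k)).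

Lemma measurable_pooled i : measurable_fun setT (pooled i).
Proof.
rewrite /pooled; under eq_fun do rewrite big_mkcond.
apply: measurable_sum => k; apply: measurable_fun_ifT => //.
have := measurable_index_undup measurable_diag (enum I) (mV k) mV.
by move=> mindex; exact: (measurableT_comp (f := fun j : nat => j == i)).
Qed.

End pooled_weights.

Section observations.
Context d (X : measurableType d) dO (Omega : measurableType dO).
Variables (Xs Ys : nat -> Omega -> X) (n m : nat).

Definition observation (k : 'I_(n + m)) : Omega -> X :=
  match fintype.split k with inl i => Xs i | inr j => Ys j end.

Definition observations w : (n + m).-tuple X := [tuple observation k w | k < n + m].

Lemma observation_lshift i : observation (lshift m i) = Xs i.
Proof. by rewrite /observation (unsplitK (inl i)). Qed.

Lemma observation_rshift j : observation (rshift n j) = Ys j.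
Proof. by rewrite /observation (unsplitK (inr j)). Qed.

Lemma preimage_observations_box (F : 'I_(n + m) -> set X) : observations @^-1` box F =
  [set w | (forall i, F (lshift m i) (Xs i w)) /\ (forall j, F (rshift n j) (Ys j w))].
Proof.
apply/seteqP; split=> [w wF|w [wX wY] k]; last first.
  rewrite tnth_mktuple; case: (split_ordP k) => i ->.
    by rewrite observation_lshift; exact: wX.
  by rewrite observation_rshift; exact: wY.
split=> i.
  by have := wF (lshift m i); rewrite tnth_mktuple observation_lshift.
by have := wF (rshift n i); rewrite tnth_mktuple observation_rshift.
Qed.

Lemma measurable_observations : (forall k, measurable_fun setT (observation k)) ->
  measurable_fun setT observations.
Proof.
move=> mobs; apply/measurable_fun_tnthP => k.
rewrite (_ : _ \o _ = observation k)//.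
by apply/funext => w; rewrite /= tnth_mktuple.
Qed.

End observations.

Section data_sigma_algebra.
Context d (X : measurableType d) dO (Omega : measurableType dO).
Variables (Xs Ys : nat -> Omega -> X) (n m : nat).
Local Notation obs := (observations Xs Ys n m).

Lemma sigma_data_preimage D : measurable D -> sigma_data Xs Ys n m (obs @^-1` D).
Proof.
pose dataOmega := g_sigma_algebraType (sigma_gen_seq Xs n `|` sigma_gen_seq Ys m).
have mobs : measurable_fun setT (obs : dataOmega -> _).
  apply: (@measurable_observations _ _ _ dataOmega) => k _ B mB; rewrite setTI.
  apply: sub_sigma_algebra; rewrite /observation; case: (fintype.split k) => i;
    [left|right]; by exists i => //=; exists B => //; rewrite setTI.
by move=> mD; rewrite -[X in sigma_data _ _ _ _ X]setTI; exact: mobs.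
Qed.

Lemma sigma_data_preimageP D : sigma_data Xs Ys n m D ->
  exists2 D', measurable D' & D = obs @^-1` D'.
Proof.
suff : sigma_data Xs Ys n m `<=` preimage_set_system setT obs measurable.
  by move=> /[apply] -[D' mD' <-]; exists D' => //; rewrite setTI.
apply: smallest_sub; first exact/sigma_algebra_preimage/sigma_algebra_measurable.
have obs_preimage (k : 'I_(n + m)) B : measurable B ->
    preimage_set_system setT obs measurable (setT `&` observation Xs Ys k @^-1` B).
  move=> mB; exists (@tnth _ X ^~ k @^-1` B).
    exact: measurable_preimageT (measurable_tnth k) mB.
  by rewrite !setTI; apply/seteqP; split=> w /=; rewrite tnth_mktuple.
move=> _ [[i ltin [B mB <-]]|[j ltjm [B mB <-]]].
  by rewrite -(@observation_lshift _ _ _ _ Xs Ys n m (Ordinal ltin)); exact: obs_preimage.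
by rewrite -(@observation_rshift _ _ _ _ Xs Ys n m (Ordinal ltjm)); exact: obs_preimage.
Qed.

Lemma measurable_wrt_observations (R : realType) (f : (n + m).-tuple X -> R) :
  measurable_fun setT f -> measurable_wrt (sigma_data Xs Ys n m) (f \o obs).
Proof. by move=> mf B mB; exact: (sigma_data_preimage (measurable_preimageT mf mB)). Qed.

Lemma distinct_vals_lshift w :
  distinct_vals Xs n w = distinct (fun k v => tnth v (lshift m k)) (obs w).
Proof.
rewrite /distinct_vals /distinct -val_enum_ord -map_comp; congr undup.
by apply: eq_map => k /=; rewrite tnth_mktuple observation_lshift.
Qed.

Lemma distinct_vals_rshift w :
  distinct_vals Ys m w = distinct (fun k v => tnth v (rshift n k)) (obs w).
Proof.
rewrite /distinct_vals /distinct -val_enum_ord -map_comp; congr undup.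
by apply: eq_map => k /=; rewrite tnth_mktuple observation_rshift.
Qed.

End data_sigma_algebra.

(** * Full-range borrowing of information *)

Lemma sigma_finite_integrable_gt0 (R : realType) d (T : measurableType d)
    (m : {measure set T -> \bar R}) (f : T -> R) :
  (forall x, 0 <= f x) -> m.-integrable setT (EFin \o f) ->
  {ae m, forall x, 0 < f x} -> sigma_finite setT m.
Proof.
move=> f_ge0 f_int [N [mN N0 f_gt0]]; have mf : measurable_fun setT f.
  exact/measurable_EFinP/(measurable_int _ f_int).
pose level k := f @^-1` `[k.+1%:R^-1, +oo[.
have mlevel k : measurable (level k) by exact: measurable_preimageT.
exists (fun k => N `|` level k) => [|k].
  apply/esym/seteqP; split=> // x _; have [/f_gt0 Nx|/contrapT fx] := pselect (~ 0 < f x).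
    by exists 0%N => //; left.
  exists (Num.truncn (f x)^-1) => //; right; rewrite /level/= in_itv/= andbT.
  by rewrite invf_ple ?posrE ?ltr0n//; exact/ltW/truncnS_gt.
split; first exact: measurableU.
apply: (@le_lt_trans _ _ (m N + m (level k))%E); first exact: measureU2.
have k_gt0 : 0 < k.+1%:R^-1 :> R by rewrite invr_gt0.
have markov : ((k.+1%:R^-1)%:E * m (level k) <= \int[m]_x `|(f x)%:E|)%E.
  rewrite (_ : level k = setT `&` [set x | ((k.+1%:R^-1)%:E <= `|(EFin \o f) x|)%E]).
    apply: (@le_integral_comp_abse _ _ _ m _ measurableT (EFin \o f) _ id) => //.
    exact/measurable_EFinP.
  by rewrite setTI; apply/seteqP; split=> x; rewrite /level/= in_itv/= andbT lee_fin ger0_norm.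
rewrite N0 add0e -(@lte_pmul2l _ (k.+1%:R^-1)%:E)// ?lte_fin//.
apply: le_lt_trans markov _; rewrite gt0_muley ?lte_fin//.
by have /integrableP[] := f_int.
Qed.

Section as_sigma_finite.
Context {R : realType} d (T : measurableType d) (m : {measure set T -> \bar R}).

Definition as_sigma_finite & sigma_finite setT m : set T -> \bar R := m.

Variable m_sf : sigma_finite setT m.

HB.instance Definition _ := Measure.copy (as_sigma_finite m_sf) m.
HB.instance Definition _ := Measure_isSigmaFinite.Build _ _ _ (as_sigma_finite m_sf) m_sf.

End as_sigma_finite.

Section total_mass.
Context {R : realType} d (Omega : measurableType d) (P : probability Omega R).

(* As [x / 0 = 0] and [fine +oo = 0], the ratio [x / x] detects positive finite [x]. *)
Lemma ae_gt0_fin_num (f : Omega -> \bar R) : measurable_fun setT f ->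
  (forall w, 0 <= f w)%E -> (\int[P]_w (fine (f w) / fine (f w))%:E = 1)%E ->
  {ae P, forall w, (0 < f w < +oo)%E}.
Proof.
move=> mf f_ge0 ratio1; pose good := f @^-1` `]0%E, +oo%E[.
have mgood : measurable good by exact: measurable_preimageT mf (emeasurable_itv _).
have ratioE w : fine (f w) / fine (f w) = \1_good w.
  rewrite indicE (_ : (w \in good) = (0 < f w < +oo)%E); last first.
    by apply/idP/idP => [/set_mem|fw]; [|apply/mem_set]; rewrite /good/= in_itv.
  move: (f_ge0 w); case: (f w) => [x| |]//=; rewrite ?ltry ?ltxx ?andbF ?invr0 ?mulr0//.
  by rewrite lee_fin lte_fin le_eqVlt => /predU1P[<-|x0]; rewrite ?ltxx ?mul0r// x0 divff// gt_eqF.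
exists (~` good); split; first exact: measurableC.
  rewrite probability_setC// -ratio1 (eq_integral (EFin \o \1_good)).
    by rewrite integral_indic// setIT subee// fin_num_measure.
  by move=> w _; rewrite ratioE.
by apply: subsetC => w; rewrite /good/= in_itv.
Qed.

End total_mass.
Section jumps.
Context {R : realType}.
Local Notation RR := (measurableTypeR R * measurableTypeR R)%type.
Variable rho : {measure set RR -> \bar R}.
Hypothesis rho_supp : rho (~` ([set s | 0 <= s.1 /\ 0 <= s.2] `\` [set (0, 0)])) = 0%E.
Hypothesis rho_int : (\int[rho]_s (Num.min 1 (s.1 + s.2))%:E < +oo)%E.

Definition jump (e : bool) (s : RR) : R := Num.max 0 (pair_coord e s).

Lemma jump_ge0 e s : 0 <= jump e s.
Proof. by rewrite le_max lexx. Qed.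

Lemma measurable_jump e : measurable_fun setT (jump e).
Proof. by apply: measurable_maxr => //; exact: measurable_pair_coord. Qed.

Lemma ae_jumpE :
  {ae rho, forall s, [/\ jump true s = s.1, jump false s = s.2 & 0 < s.1 + s.2]}.
Proof.
exists (~` ([set s | 0 <= s.1 /\ 0 <= s.2] `\` [set (0, 0)])); split=> //.
  apply: measurableC; apply: measurableD; last first.
    rewrite (_ : [set (0, 0)] = [set 0] `*` [set 0]); first exact: measurableX.
    by apply/seteqP; split=> -[x y] [/= -> ->].
  rewrite (_ : [set s | _] = fst @^-1` `[0, +oo[ `&` snd @^-1` `[0, +oo[).
    exact: measurableI (measurable_preimageT measurable_fst (measurable_itv _))
      (measurable_preimageT measurable_snd (measurable_itv _)).
  by apply/seteqP; split=> s /=; rewrite !in_itv/= !andbT.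
apply: subsetC => -[x y] /= [[x0 y0] xy0]; split; [exact/max_idPr|exact/max_idPr|].
rewrite lt_neqAle eq_sym addr_ge0// andbT paddr_eq0//.
by apply/negP => /andP[/eqP x00 /eqP y00]; apply: xy0; rewrite x00 y00.
Qed.

Lemma integrable_min_jump :
  rho.-integrable setT (EFin \o (fun s => Num.min 1 (jump true s + jump false s))).
Proof.
have mmin : measurable_fun setT (fun s => Num.min 1 (jump true s + jump false s)).
  by apply: measurable_minr => //; apply: measurable_funD; exact: measurable_jump.
apply/ge0_integrable_EFinP => // [s|]; first by rewrite le_min ler01 addr_ge0 ?jump_ge0.
rewrite (ae_eq_integral (fun s : RR => (Num.min 1 (s.1 + s.2))%:E))//.
- exact/measurable_EFinP.
- by apply/measurable_EFinP/measurable_minr => //; exact: measurable_funD.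
by apply: filterS ae_jumpE => s [-> ->].
Qed.

Lemma sigma_finite_jumps : sigma_finite setT rho.
Proof.
apply: sigma_finite_integrable_gt0 integrable_min_jump _ => [s|].
  by rewrite le_min ler01 addr_ge0 ?jump_ge0.
by apply: filterS ae_jumpE => s [-> -> s_gt0]; rewrite lt_min ltr01.
Qed.

Lemma Rintegral_onem_expRN_jump (x : R * R) :
  Rintegral rho setT (fun s => 1 - expR (- (x.1 * jump true s + x.2 * jump false s))) =
  fine (\int[rho]_s (1 - expR (- (x.1 * s.1 + x.2 * s.2)))%:E).
Proof.
congr fine; apply: ae_eq_integral => //.
- apply/measurable_EFinP/measurable_funB/measurable_expRN => //.
  by apply: measurable_funD; apply: measurable_funM => //; exact: measurable_jump.
- apply/measurable_EFinP/measurable_funB/measurable_expRN => //.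
  by apply: measurable_funD; exact: measurable_funM.
by apply: filterS ae_jumpE => s [-> ->].
Qed.

End jumps.

Section extend.
Context {T : Type} (n : nat) (b : bool).
Implicit Types (F : 'I_n -> set T) (C : set T).

Definition extend F C (i : nat) : set T := oapp F C (insub i).

Lemma extend_ord F C (i : 'I_n) : extend F C i = F i.
Proof. by rewrite /extend valK. Qed.

Lemma extend_size F C : extend F C n = C.
Proof. by rewrite /extend insubN// ltnn. Qed.

Lemma bigcap_extend (Omega : Type) (V : nat -> Omega -> T) F C :
  \bigcap_(i in `I_(n + b)) V i @^-1` extend F C i =
  [set w | (forall i : 'I_n, F i (V i w)) /\ (b -> C (V n w))].
Proof.
apply/seteqP; split=> [w VF|w [VF VC] i /= ib].
  split=> [i|bT].
    by have := VF i; rewrite /preimage/= extend_ord; apply; rewrite ltn_addr.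
  by have := VF n; rewrite /preimage/= extend_size; apply; rewrite bT addn1.
have [ltin|leni] := ltnP i n.
  by rewrite /preimage/= -[i]/(nat_of_ord (Ordinal ltin)) extend_ord; exact: VF.
move: ib VC; case: b => /=; rewrite ?addn1 ?addn0 => ib; last by rewrite ltnNge leni in ib.
rewrite (_ : i = n); last by apply/eqP; rewrite eqn_leq leni -ltnS ib.
by move=> /(_ isT) VC; rewrite /preimage/= extend_size.
Qed.

Lemma prod_extend (R : pzRingType) (f : set T -> R) F C :
  \prod_(i < n + b) f (extend F C i) = \prod_(i < n) f (F i) * (if b then f C else 1).
Proof.
have prodF : \prod_(i < n) f (extend F C i) = \prod_(i < n) f (F i).
  by apply: eq_bigr => i _; rewrite extend_ord.
by case: b; rewrite ?addn1 ?addn0 ?big_ord_recr/= prodF ?extend_size ?mulr1.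
Qed.

End extend.

Section sampling.
Context {R : realType} d (X : measurableType d) dO (Omega : measurableType dO)
  (P : probability Omega R).
Variables (mu1 mu2 : Omega -> {measure set (X * X)%type -> \bar R}).
Variables (Xs Ys : nat -> Omega -> X).
Hypothesis sampled : cond_iid P mu1 mu2 Xs Ys.

Definition measures (e : bool) := if e then mu1 else mu2.

Lemma law_sample (a b : nat) (A B : nat -> set X) :
  (forall i, measurable (A i)) -> (forall j, measurable (B j)) ->
  P ((\bigcap_(i in `I_a) (Xs i @^-1` A i)) `&` (\bigcap_(j in `I_b) (Ys j @^-1` B j))) =
  (\int[P]_w ((\prod_(i < a) share measures true w (cylinder true (A i))) *
              (\prod_(j < b) share measures false w (cylinder false (B j))))%:E)%E.
Proof.
move=> mA mB; have [_ [_ law]] := sampled.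
have trivial_event : sigma_ptilde mu1 mu2 setT.
  have [s0 sC _] : sigma_algebra setT (sigma_ptilde mu1 mu2) := smallest_sigma_algebra _ _.
  by have := sC _ s0; rewrite setD0.
have := law a b A B setT mA mB trivial_event; rewrite setTI => ->.
apply: eq_integral => w _; congr (_ * _)%:E; apply: eq_bigr => i _.
  by rewrite /share cylinder_trueE.
by rewrite /share cylinder_falseE.
Qed.

Lemma ae_mass : (forall e A, measurable A -> measurable_fun setT (fun w => measures e w A)) ->
  {ae P, forall w, forall e, (0 < measures e w setT < +oo)%E}.
Proof.
move=> mmu.
have mass e : {ae P, forall w, (0 < measures e w setT < +oo)%E}.
  apply: ae_gt0_fin_num => //; first exact: mmu.
  transitivity (\int[P]_w (share measures e w (cylinder e setT))%:E)%E => //.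
  have := @law_sample e (~~ e) (fun=> setT) (fun=> setT) (fun=> measurableT) (fun=> measurableT).
  rewrite (_ : _ `&` _ = setT); last by apply/seteqP; split.
  rewrite probability_setT => ->; apply: eq_integral => w _.
  by case: e; rewrite big_ord1 big_ord0 ?mulr1 ?mul1r.
by apply: filterS2 (mass true) (mass false) => w T1 T2 [].
Qed.

Variables (n m : nat) (e_next : bool).

Definition from_first (k : 'I_(n + m)) : bool := if fintype.split k is inl _ then true else false.

Lemma from_first_lshift i : from_first (lshift m i) = true.
Proof. by rewrite /from_first (unsplitK (inl i)). Qed.

Lemma from_first_rshift j : from_first (rshift n j) = false.
Proof. by rewrite /from_first (unsplitK (inr j)). Qed.

Definition next_observation : Omega -> X := if e_next then Xs n else Ys m.

Lemma law_items F C : (forall k, measurable (F k)) -> measurable C ->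
  P (observations Xs Ys n m @^-1` box F `&` next_observation @^-1` C) =
  (\int[P]_w (\prod_(o <- None :: map Some (enum 'I_(n + m)))
     share measures (item_coord from_first e_next o) w (item_event from_first e_next F C o))%:E)%E.
Proof.
move=> mF mC; pose F1 i := F (lshift m i); pose F2 j := F (rshift n j).
have mext p (G : 'I_p -> set X) i : (forall k, measurable (G k)) -> measurable (extend G C i).
  by move=> mG; rewrite /extend; case: (insub i).
rewrite (_ : _ `&` _ = (\bigcap_(i in `I_(n + e_next)) (Xs i @^-1` extend F1 C i)) `&`
    (\bigcap_(j in `I_(m + ~~ e_next)) (Ys j @^-1` extend F2 C j))).
  rewrite law_sample//; [|by move=> i; apply: mext => k; exact: mF..].
  apply: eq_integral => w _; congr EFin.
  rewrite (prod_extend _ (fun A => share measures true w (cylinder true A))).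
  rewrite (prod_extend _ (fun A => share measures false w (cylinder false A))).
  rewrite big_cons big_map big_enum big_split_ord/=.
  under [X in _ = _ * (X * _)]eq_bigr do rewrite /item_event/= from_first_lshift.
  under [X in _ = _ * (_ * X)]eq_bigr do rewrite /item_event/= from_first_rshift.
  by rewrite /item_event; case: e_next => /=; ring.
rewrite !bigcap_extend preimage_observations_box /next_observation.
apply/seteqP; split=> w; first by case=> -[wX wY]; case: e_next.
by case: e_next => -[[wX wC] [wY wC']]; split=> //=; [exact: wC|exact: wC'].
Qed.

End sampling.

Lemma big_option (R : Type) (idx : R) (op : Monoid.com_law idx) (T : finType)
    (F : option T -> R) :
  \big[op/idx]_o F o = op (F None) (\big[op/idx]_k F (Some k)).
Proof.
rewrite (bigD1 None)//= (reindex_omap Some id)//=; last by case.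
by congr (op _ _); apply: eq_bigl => k; rewrite eqxx.
Qed.

Section predictive_law.
Context {R : realType} d (X : measurableType d) (theta : R)
  (G0 : probability (X * X)%type R) (P0 : probability X R).
Hypothesis theta_gt0 : 0 < theta.
Hypothesis marginal : forall A : set X, measurable A ->
  G0 (A `*` setT) = P0 A /\ G0 (setT `*` A) = P0 A.
Variable rho : {measure set (measurableTypeR R * measurableTypeR R)%type -> \bar R}.
Hypothesis rho_supp : rho (~` ([set s | 0 <= s.1 /\ 0 <= s.2] `\` [set (0, 0)])) = 0%E.
Hypothesis rho_int : (\int[rho]_s (Num.min 1 (s.1 + s.2))%:E < +oo)%E.
Variables (lam : {sigma_finite_measure set X -> \bar R}) (g0 : X * X -> R) (p0 : X -> R).
Hypotheses (mg0 : measurable_fun setT g0) (g0_ge0 : forall z, 0 <= g0 z).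
Hypothesis G0_density : forall A : set (X * X), measurable A ->
  G0 A = (\int[(lam \x lam)%E]_(z in A) (g0 z)%:E)%E.
Hypotheses (mp0 : measurable_fun setT p0) (p0_ge0 : forall x, 0 <= p0 x).
Hypothesis P0_density : forall A : set X, measurable A ->
  P0 A = (\int[lam]_(x in A) (p0 x)%:E)%E.
Variables (dO : measure_display) (Omega : measurableType dO) (P : probability Omega R).
Variables (mu1 mu2 : Omega -> {measure set (X * X)%type -> \bar R}).
Hypothesis crv : completely_random_vector P theta rho G0 mu1 mu2.
Variables Xs Ys : nat -> Omega -> X.
Hypothesis sampled : cond_iid P mu1 mu2 Xs Ys.
Variables (n m : nat) (e_next : bool).
Hypotheses (n_gt0 : (0 < n)%N) (m_gt0 : (0 < m)%N).

Local Notation N := (n + m)%N.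
Local Notation side := (@from_first n m).
Local Notation obs := (observations Xs Ys n m).
Local Notation next := (next_observation Xs Ys n m e_next).
Local Notation configurations := (seq_partitions (None :: map Some (enum 'I_N))).

Lemma law_configurations : exists2 wt : seq (seq (option 'I_N)) -> R, (forall c, 0 <= wt c) &
  forall F C, (forall k, measurable (F k)) -> measurable C ->
  P (obs @^-1` box F `&` next @^-1` C) =
  (\sum_(c <- configurations) wt c * component_mass G0 side e_next c F C)%:E.
Proof.
have [mmu indep laplace] := crv.
have mmeasures e A : measurable A -> measurable_fun setT (fun w => measures mu1 mu2 e w A).
  by move=> /mmu[]; case: e.
pose rho_sf : {sigma_finite_measure set (measurableTypeR R * measurableTypeR R)%type -> \bar R} :=
  as_sigma_finite (sigma_finite_jumps rho_supp rho_int).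
have laplace_mu (A : set (X * X)) (x : R * R) : measurable A -> 0 <= x.1 -> 0 <= x.2 ->
    (\int[P]_w (expmE (x.1%:E * measures mu1 mu2 true w A +
                       x.2%:E * measures mu1 mu2 false w A)%E)%:E)%E =
    (expR (- (theta * fine (G0 A) * levy_exponent rho_sf (@jump R) x)))%:E.
  move=> mA x1 x2; rewrite (laplace A x.1 x.2 mA x1 x2).
  by rewrite /levy_exponent -(Rintegral_onem_expRN_jump rho_supp).
have has_true : has (item_coord side e_next) (None :: map Some (enum 'I_N)).
  apply/hasP; exists (Some (lshift m (Ordinal n_gt0))); last exact: from_first_lshift.
  by rewrite inE map_f ?mem_enum.
have has_false : has (predC (item_coord side e_next)) (None :: map Some (enum 'I_N)).
  apply/hasP; exists (Some (rshift n (Ordinal m_gt0))); last by rewrite /= from_first_rshift.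
  by rewrite inE map_f ?mem_enum.
have [wt wt_ge0 momentsE] := @share_moments _ _ _ G0 _ _ rho_sf _ _ (ltW theta_gt0)
  (@measurable_jump R) (@jump_ge0 R) (integrable_min_jump rho_supp rho_int) _ _ P _
  mmeasures indep laplace_mu (ae_mass sampled mmeasures) _ _ _ has_true has_false.
exists wt => // F C mF mC; rewrite (law_items sampled)// momentsE// => o.
exact: measurable_item_event.
Qed.

Local Notation kernel := (next_kernel P0 lam g0 p0 side e_next).

Lemma posterior_weights : exists g : option 'I_N -> N.-tuple X -> R,
  [/\ forall o, measurable_fun setT (g o),
      forall o v, 0 <= g o v,
      forall v, \sum_o g o v = 1 &
      forall D C, measurable D -> measurable C ->
        (P (obs @^-1` D `&` next @^-1` C) =
         \int[P]_(w in obs @^-1` D) \sum_o (g o (obs w))%:E * kernel o (obs w) C)%E].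
Proof.
have [wt wt_ge0 lawE] := law_configurations.
have [mX [mY _]] := sampled.
have mobs : measurable_fun setT obs.
  by apply: measurable_observations => k; rewrite /observation; case: (fintype.split k).
have mnext : measurable_fun setT next by rewrite /next_observation; case: e_next.
pose obs_mfun : {mfun Omega >-> N.-tuple X} :=
  HB.pack obs (isMeasurableFun.Build _ _ _ _ _ mobs).
pose next_mfun : {mfun Omega >-> X} := HB.pack next (isMeasurableFun.Build _ _ _ _ _ mnext).
pose conf (i : 'I_(size configurations)) := tnth (in_tuple configurations) i.
have /choice[comp compE] i : exists kappa_o : probability (N.-tuple X) R * option 'I_N,
    component_law G0 P0 lam g0 p0 side e_next (conf i) kappa_o.1 kappa_o.2.
  have [kappa [kind law_c]] := exists_component_law marginal mg0 g0_ge0 G0_density mp0 p0_ge0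
    P0_density side e_next (mem_tnth i (in_tuple configurations)).
  by exists (kappa, kind).
have i0 := Ordinal (size_seq_partitions_gt0 (None :: map Some (enum 'I_N))).
apply: (@predictive_weights _ _ _ _ _ i0 _ _ P _ _ _ obs_mfun next_mfun (wt \o conf)
  (fun i => (comp i).1) (fun i => (comp i).2)) => [i|? ? ?|? ? ?|F mF|F C mF mC].
- exact: wt_ge0.
- exact: next_kernel_ge0.
- exact: measurable_next_kernel.
- rewrite -[obs_mfun @^-1` _]setIT -(preimage_setT next) lawE// big_tnth -sumEFin.
  by apply: eq_bigr => i _; have [massE _] := compE i F mF; rewrite EFinM massE.
- rewrite lawE// big_tnth -sumEFin; apply: eq_bigr => i _.
  by have [_ massE] := compE i F mF; rewrite EFinM massE.
Qed.

Hypothesis measurable_diag : measurable [set z : X * X | z.1 = z.2].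

Local Notation seen e := (seen_kernel lam g0 p0 e e_next).

Lemma predictive_law : exists (xi0 : Omega -> R) (xix xiy : nat -> Omega -> R),
  let F := sigma_data Xs Ys n m in
  let xs := distinct_vals Xs n in
  let ys := distinct_vals Ys m in
  [/\ measurable_wrt F xi0 /\ (forall i, measurable_wrt F (xix i))
        /\ (forall j, measurable_wrt F (xiy j)),
      (forall w, 0 <= xi0 w /\ (forall i, 0 <= xix i w) /\ (forall j, 0 <= xiy j w)),
      (forall w, xi0 w + \sum_(i < size (xs w)) xix i w
                       + \sum_(j < size (ys w)) xiy j w = 1) &
      forall C, measurable C -> forall D, F D ->
        P (D `&` next @^-1` C) =
        (\int[P]_(w in D)
           ((xi0 w)%:E * P0 C
            + \sum_(i < size (xs w)) (xix i w)%:E * seen true (nth point (xs w) i) C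
            + \sum_(j < size (ys w)) (xiy j w)%:E * seen false (nth point (ys w) j) C))%E].
Proof.
have [g [mg g_ge0 sum_g lawE]] := posterior_weights.
pose VX (i : 'I_n) (v : N.-tuple X) := tnth v (lshift m i).
pose VY (j : 'I_m) (v : N.-tuple X) := tnth v (rshift n j).
pose gX i := g (Some (lshift m i)); pose gY j := g (Some (rshift n j)).
exists (g None \o obs), (fun i => pooled VX gX i \o obs), (fun j => pooled VY gY j \o obs).
split.
- split; first exact: measurable_wrt_observations.
  split=> i; apply: measurable_wrt_observations; apply: measurable_pooled => // k;
    by [exact: (measurable_tnth (lshift m k))|exact: (measurable_tnth (rshift n k))|exact: mg].
- by move=> w; split; [exact: g_ge0|split=> i; apply: pooled_ge0 => k v; exact: g_ge0].
- move=> w; rewrite (distinct_vals_lshift _ Ys _ m) (distinct_vals_rshift Xs _ n) /= !sum_pooled.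
  by rewrite -[RHS](sum_g (obs w)) big_option big_split_ord/= addrA.
move=> C mC _ /sigma_data_preimageP[D mD ->]; rewrite lawE//.
apply: eq_integral => w _; rewrite (distinct_vals_lshift _ Ys _ m) (distinct_vals_rshift Xs _ n).
rewrite (esum_pooled _ (fun k => g_ge0 (Some (lshift m k))) _ (seen true ^~ C)).
rewrite (esum_pooled _ (fun k => g_ge0 (Some (rshift n k))) _ (seen false ^~ C)).
rewrite big_option big_split_ord/= addeA; congr (_ + _ + _)%E; apply: eq_bigr => k _.
  by rewrite from_first_lshift.
by rewrite from_first_rshift.
Qed.

End predictive_law.

Theorem theorem2
  (R : realType) (d : measure_display) (X : measurableType d)
  (HX : polish_space R X)
  (theta : R) (Htheta : 0 < theta)
  (G0 : probability (X * X)%type R) (P0 : probability X R)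
  (HG0na : forall z : X * X, G0 [set z] = 0%E)
  (HG0marg : forall A : set X, measurable A ->
      G0 (A `*` setT) = P0 A /\ G0 (setT `*` A) = P0 A)
  (rho : {measure set (measurableTypeR R * measurableTypeR R)%type -> \bar R})
  (Hrho_supp : rho (~` ([set s | 0 <= s.1 /\ 0 <= s.2] `\` [set (0, 0)])) = 0%E)
  (Hrho_int : (\int[rho]_s (Num.min 1 (s.1 + s.2))%:E < +oo)%E)
  (Hrho_marg : forall A : set R, measurable A -> A `<=` `]0, +oo[ ->
      rho (A `*` setT) = rho (setT `*` A))
  (Hrho_inf : rho [set s | 0 < s.1] = +oo%E)
  (lam : {sigma_finite_measure set X -> \bar R})
  (g0 : X * X -> R) (p0 : X -> R)
  (Hg0m : measurable_fun setT g0) (Hg0pos : forall z, 0 <= g0 z)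
  (Hg0 : forall A : set (X * X), measurable A ->
      G0 A = (\int[(lam \x lam)%E]_(z in A) (g0 z)%:E)%E)
  (Hp0m : measurable_fun setT p0) (Hp0pos : forall x, 0 <= p0 x)
  (Hp0 : forall A : set X, measurable A -> P0 A = (\int[lam]_(x in A) (p0 x)%:E)%E)
  (dO : measure_display) (Omega : measurableType dO) (P : probability Omega R)
  (mu1 mu2 : Omega -> {measure set (X * X)%type -> \bar R})
  (Hmu : completely_random_vector P theta rho G0 mu1 mu2)
  (Xs Ys : nat -> Omega -> X)
  (Hsample : cond_iid P mu1 mu2 Xs Ys)
  (n m : nat) (Hn : (0 < n)%N) (Hm : (0 < m)%N) :
  let F := sigma_data Xs Ys n m in
  let xs := distinct_vals Xs n in
  let ys := distinct_vals Ys m in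
  (exists (xi0 : Omega -> R) (xix xiy : nat -> Omega -> R),
    [/\ measurable_wrt F xi0 /\ (forall i, measurable_wrt F (xix i))
          /\ (forall j, measurable_wrt F (xiy j)),
        (forall w, 0 <= xi0 w /\ (forall i, 0 <= xix i w) /\ (forall j, 0 <= xiy j w)),
        (forall w, xi0 w + \sum_(i < size (xs w)) xix i w
                         + \sum_(j < size (ys w)) xiy j w = 1) &
        forall C : set X, measurable C -> forall D : set Omega, F D ->
          P (D `&` (Xs n @^-1` C)) =
          (\int[P]_(w in D)
             ((xi0 w)%:E * P0 C
              + \sum_(i < size (xs w)) (xix i w)%:E * \d_(nth point (xs w) i) C
              + \sum_(j < size (ys w)) (xiy j w)%:E * Rker lam g0 p0 (nth point (ys w) j) C))%E])
  /\
  (exists (eta0 : Omega -> R) (etay etax : nat -> Omega -> R),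
    [/\ measurable_wrt F eta0 /\ (forall j, measurable_wrt F (etay j))
          /\ (forall i, measurable_wrt F (etax i)),
        (forall w, 0 <= eta0 w /\ (forall j, 0 <= etay j w) /\ (forall i, 0 <= etax i w)),
        (forall w, eta0 w + \sum_(j < size (ys w)) etay j w
                          + \sum_(i < size (xs w)) etax i w = 1) &
        forall C : set X, measurable C -> forall D : set Omega, F D ->
          P (D `&` (Ys m @^-1` C)) =
          (\int[P]_(w in D)
             ((eta0 w)%:E * P0 C
              + \sum_(j < size (ys w)) (etay j w)%:E * \d_(nth point (ys w) j) C
              + \sum_(i < size (xs w)) (etax i w)%:E * Qker lam g0 p0 (nth point (xs w) i) C))%E]).
Proof.
move=> F xs ys.
have predict e_next := predictive_law Htheta HG0marg Hrho_supp Hrho_int Hg0m Hg0pos Hg0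
  Hp0m Hp0pos Hp0 Hmu Hsample e_next Hn Hm (measurable_diagonal HX).
split; first exact: (predict true).
have [eta0 [etax [etay [[m0 [mx my]] eta_ge0 sum_eta lawE]]]] := predict false.
exists eta0, etay, etax; split=> //.
- by move=> w; have [? []] := eta_ge0 w.
- by move=> w; rewrite addrAC; exact: sum_eta.
by move=> C mC D FD; rewrite lawE//; apply: eq_integral => w _; rewrite addeAC.
Qed.
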